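(* Let $Y_2\sim Bi(M,p)$ with $M\in\mathbb{N}$, $0<p<1$, $q=1-p$; let $Y_3\sim \mathrm{NB}(r,\bar p)$ with $r>0$, $0<\bar p<1$, $\bar q=1-\bar p$; and let $Y_4$ be a compound Poisson random variable with probability generating function $G_{cp}(z)=\exp\{\sum_{j=1}^\infty\lambda_j(z^j-1)\}$, where $\lambda_j\ge 0$ and $\lambda:=\sum_{j=1}^\infty j\lambda_j<\infty$. Assume that $Y_2,Y_3,Y_4$ are independent. Then: (i) The random variable $Y_{24}=Y_2+Y_4$ has probability generating function $(q+pz)^M G_{cp}(z)$, and a Stein operator for $Y_{24}$ is $$(\mathcal{A}g)(j)=\Big(M+\frac{\lambda}{p}-j\Big)p\,g(j+1)-qj\,g(j)+\sum_{m=2}^\infty\big(qm\lambda_m+p(m-1)\lambda_{m-1}\big)\sum_{l=1}^{m-1}\Delta g(j+l),\quad j\in\mathbb{Z}_+,$$ i.e. $\mathbb{E}(\mathcal{A}g)(Y_{24})=0$ for every $g\in\mathcal{G}_{Y_{24}}$. (ii) The random variable $Y_{34}=Y_3+Y_4$ has probability generating function $\big(\frac{\bar p}{1-\bar q z}\big)^rG_{cp}(z)$, and a Stein operator for $Y_{34}$ is $$(\mathcal{A}g)(j)=\Big(\frac{\lambda\bar p}{\bar q}+r+j\Big)\bar q\,g(j+1)-j\,g(j)+\sum_{m=2}^\infty\big(m\lambda_m-\bar q(m-1)\lambda_{m-1}\big)\sum_{l=1}^{m-1}\Delta g(j+l),\quad j\in\mathbb{Z}_+,$$ i.e. $\mathbb{E}(\mathcal{A}g)(Y_{34})=0$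 for every $g\in\mathcal{G}_{Y_{34}}$.
   Context: $\mathbb{Z}_+=\{0,1,2,\dots\}$. $\Delta g(j)=g(j+1)-g(j)$. For a $\mathbb{Z}_+$-valued random variable $Y$ with finite mean, $\mathcal{G}_Y$ is the set of bounded functions $g:\mathbb{Z}_+\to\mathbb{R}$ with $g(0)=0$ and $g(x)=0$ for $x\notin \mathrm{supp}(Y)$. A Stein operator for $Y$ is a linear operator $\mathcal{A}$ such that $\mathbb{E}(\mathcal{A}g)(Y)=0$ for all $g\in\mathcal{G}_Y$. $Bi(M,p)$ is the binomial distribution with probability generating function $(q+pz)^M$. $\mathrm{NB}(r,\bar p)$ is the negative binomial distribution with $P(Y_3=j)=\frac{\Gamma(r+j)}{\Gamma(r)j!}\bar p^r\bar q^j$, $j\in\mathbb{Z}_+$. The compound Poisson variable is $Y_4=\sum_{j=1}^N X_j$ with $N$ Poisson with parameter $\Lambda>0$, independent of the iid $\mathbb{Z}_+$-valued $X_j$, and $\lambda_j=\Lambda P(X_1=j)$ for $j\ge1$. *)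

(* Defs.v *)
From HB Require Import structures.
From mathcomp Require Import all_boot all_order all_algebra.
From mathcomp Require Import all_classical all_reals all_analysis.

Set Implicit Arguments.
Unset Strict Implicit.
Unset Printing Implicit Defensive.

Import Order.TTheory GRing.Theory Num.Theory.
Import numFieldNormedType.Exports.

Local Open Scope classical_set_scope.
Local Open Scope ring_scope.

Definition has_pmf {d} {T : measurableType d} {R : realType}
    (P : probability T R) (Y : T -> nat) (f : nat -> R) : Prop :=
  forall k : nat, P (Y @^-1` [set k]) = (f k)%:E.

(* Mutual independence: the product rule over every finite subfamily. *)
Definition mutually_independent {d} {T : measurableType d} {R : realType}
    (P : probability T R) {I : eqType} (X : I -> T -> nat) : Prop :=
  forall (J : seq I) (A : I -> set nat), uniq J ->
    P (\bigcap_(i in [set` J]) (X i @^-1` A i)) =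
    (\prod_(i <- J) P (X i @^-1` A i))%E.

Definition Gamma {R : realType} (x : R) : R :=
  \int[lebesgue_measure]_(t in `]0, +oo[) (t `^ (x - 1) * expR (- t)).

Definition negative_binomial_pmf {R : realType} (r pbar : R) (j : nat) : R :=
  Gamma (r + j%:R) / (Gamma r * j`!%:R) * pbar `^ r * (1 - pbar) ^+ j.

(* [Y] has the law of X_1 + ... + X_N, where N is Poisson(Lambda), the X_j are
   iid and independent of N, and lam j = Lambda * P(X_1 = j) for j >= 1; the
   value [lam 0] is irrelevant. The sequence X_1, X_2, ... is indexed from 0,
   and N is the member [None] of the independent family. The random sum may
   live on another probability space than [Y], as only its law matters. *)
Definition compound_poisson {d} {T : measurableType d} {R : realType}
    (P : probability T R) (Y : T -> nat) (lam : nat -> R) : Prop :=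
  exists (d' : measure_display) (T' : measurableType d')
      (P' : probability T' R) (N : {RV P' >-> nat})
      (X : nat -> {RV P' >-> nat}) (Lambda : R),
    [/\ 0 < Lambda /\ has_pmf P' N (poisson_pmf Lambda),
        forall j k, P' (X j @^-1` [set k]) = P' (X 0%N @^-1` [set k]),
        mutually_independent P'
          (fun i : option nat => if i is Some j then X j : T' -> nat else N),
        forall j, (1 <= j)%N ->
          (lam j)%:E = (Lambda%:E * P' (X 0%N @^-1` [set j]))%E &
        forall k, P (Y @^-1` [set k]) =
                  P' [set w | (\sum_(j < N w) X j w)%N = k]].

Definition pgf {d} {T : measurableType d} {R : realType}
    (P : probability T R) (Y : T -> nat) (z : R) : \bar R :=
  ('E_P[fun w => (z ^+ Y w)%R])%E.

Definition G_cp {R : realType} (lam : nat -> R) (z : R) : R :=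
  expR (\big[+%R/0]_(1 <= j <oo) (lam j * (z ^+ j - 1))).

Definition Delta {R : realType} (g : nat -> R) (j : nat) : R := g j.+1 - g j.

Definition supp {d} {T : measurableType d} {R : realType}
    (P : probability T R) (Y : T -> nat) : set nat :=
  [set k | (0 < P (Y @^-1` [set k]))%E].

Definition stein_class {d} {T : measurableType d} {R : realType}
    (P : probability T R) (Y : T -> nat) : set (nat -> R) :=
  [set g | [/\ exists C : R, forall x, `|g x| <= C,
               g 0%N = 0 &
               forall x, ~ supp P Y x -> g x = 0]].

(* The first clause records that Stein operators are only considered for
   variables with finite mean. Integrability is required because the
   expectation is a total operator on functions. *)
Definition stein_operator {d} {T : measurableType d} {R : realType}
    (P : probability T R) (Y : T -> nat)
    (A : (nat -> R) -> nat -> R) : Prop :=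
  [/\ P.-integrable [set: T] (fun w => ((Y w)%:R : R)%:E),
      forall (a b : R) (g h : nat -> R),
        stein_class P Y g -> stein_class P Y h ->
        forall j, A (fun k => a * g k + b * h k) j = a * A g j + b * A h j &
      forall g, stein_class P Y g ->
        P.-integrable [set: T] (fun w => (A g (Y w))%:E) /\
        ('E_P[fun w => A g (Y w)] = 0)%E].

(* Main.v *)
(* Write [conv] for the Cauchy product, D for the formal derivative of a
   generating function and S for multiplication by z.  The mass function c of a
   compound Poisson law is a Poisson mixture of convolution powers, so
   D c = conv l c with l j = (j + 1) lam (j + 1) (Panjer's recursion).  The
   binomial and negative binomial mass functions f satisfy
   s D f k = (a + b k) f k, with (s, a, b) = (q, M p, - p) and
   (1, r qbar, qbar).  As D is a derivation, h := conv f c satisfies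
   s D h k = (a + b k) h k + conv w h k  with  w := s l - b S l.
   The sum over l in the Stein operator telescopes to g (j + m) - g (j + 1),
   and its coefficients are the w (m - 1); since w sums to (s - b) lambda,
   exchanging the sums turns E (A g)(Y) into a telescoping series, which
   vanishes at infinity because the mean is finite.  The generating functions
   multiply by Cauchy products; that of the negative binomial law is obtained
   from the differential equation (1 - qbar z) G' = r qbar G. *)

Require Import Defs.
From HB Require Import structures.
From mathcomp Require Import all_boot all_order all_algebra.
From mathcomp Require Import all_classical all_reals all_analysis.
From mathcomp Require Import measurable_realfun ring lra zify.

Set Implicit Arguments.
Unset Strict Implicit.
Unset Printing Implicit Defensive.

Import Order.TTheory GRing.Theory Num.Theory.
Import numFieldNormedType.Exports.

Local Open Scope classical_set_scope.
Local Open Scope ring_scope.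

(** * Series of reals *)

Section series_lemmas.
Context {R : realType}.
Implicit Types (u v : nat -> R) (l : R).

Lemma cvg_series_EFin u l :
  series u @ \oo --> l -> (\sum_(0 <= i <oo) (u i)%:E)%E = l%:E.
Proof.
move=> ul; apply/cvg_lim => //.
under eq_fun do rewrite sumEFin.
by apply: cvg_EFin => //; exact: nearW.
Qed.

Lemma EFin_cvg_series u l : (forall i, 0 <= u i) ->
  (\sum_(0 <= i <oo) (u i)%:E)%E = l%:E -> series u @ \oo --> l.
Proof.
move=> u0 ul.
have : (fun n => (\sum_(0 <= i < n) (u i)%:E)%E) @ \oo --> l%:E.
  by rewrite -ul; apply: is_cvg_nneseries => n _ _; rewrite lee_fin.
move=> /fine_cvg; apply: cvg_trans.
by apply: near_eq_cvg; apply: nearW => n /=; rewrite sumEFin.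
Qed.

Lemma series_ge0 u n : (forall i, 0 <= u i) -> 0 <= series u n.
Proof. by move=> u0; apply: sumr_ge0. Qed.

Lemma series_le_lim u l n : (forall i, 0 <= u i) ->
  series u @ \oo --> l -> series u n <= l.
Proof.
move=> u0 ul; rewrite -(cvg_lim _ ul)//; apply: nondecreasing_cvgn_le.
  by apply: nondecreasing_series.
by apply/cvg_ex; exists l.
Qed.

Lemma nonneg_series_bounded_cvg u l : (forall i, 0 <= u i) ->
  (forall n, series u n <= l) -> cvgn (series u).
Proof.
move=> u0 ul; apply: nondecreasing_is_cvgn.
  by apply: nondecreasing_series.
by exists l => _ [n _ <-].
Qed.

Lemma cvg_series_abs u v : (forall i, `|u i| <= v i) -> cvgn (series v) ->
  cvgn (series (fun i => `|u i|)).
Proof.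
move=> uv cv; apply: (series_le_cvg _ _ uv cv) => // n.
exact: le_trans (uv n).
Qed.

Lemma abs_cvg_series u : cvgn (series (fun i => `|u i|)) -> cvgn (series u).
Proof. exact: normed_cvg. Qed.

Lemma cvg_seriesD u v k l : series u @ \oo --> k -> series v @ \oo --> l ->
  series (fun i => u i + v i) @ \oo --> k + l.
Proof. by move=> uk vl; rewrite (seriesD u v); exact: cvgD. Qed.

Lemma cvg_seriesZ c u l : series u @ \oo --> l ->
  series (fun i => c * u i) @ \oo --> c * l.
Proof. by move=> ul; rewrite (seriesZ u c); exact: cvgMl_tmp. Qed.

Lemma cvg_series_shift u l i : series u @ \oo --> l ->
  series (fun n => if (i <= n)%N then u (n - i)%N else 0) @ \oo --> l.
Proof.
move=> ul; rewrite -(cvg_shiftn i); apply: cvg_trans ul.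
apply: near_eq_cvg; apply: nearW => n /=.
rewrite /series /= [RHS](big_cat_nat (n := i)) ?leq_addl//=.
rewrite [X in _ = X + _]big_nat_cond [X in _ = X + _]big1 ?add0r; last first.
  by move=> k /andP[/andP[_ ki] _]; rewrite leqNgt ki.
rewrite -[in RHS](add0n i) big_addn addnK.
by apply: eq_bigr => k _; rewrite leq_addl addnK.
Qed.

Lemma cvg_series_finite u n : (forall i, (n <= i)%N -> u i = 0) ->
  series u @ \oo --> \sum_(i < n) u i.
Proof.
move=> u0; rewrite -(cvg_shiftn n); apply: cvg_near_cst; apply: nearW => k.
rewrite /series /= (big_cat_nat (n := n)) ?leq_addl//= big_mkord.
rewrite [X in _ + X]big_nat_cond [X in _ + X]big1 ?addr0//.
by move=> i /andP[/andP[ni _] _]; exact: u0.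
Qed.

(** Each column is dominated termwise by the summable row sums [s], hence converges. The totals are
    then compared in the extended reals, where nonnegative series commute. *)
Lemma series_tonelli (a : nat -> nat -> R) (s : nat -> R) (S : R) :
  (forall i j, 0 <= a i j) ->
  (forall i, series (a i) @ \oo --> s i) -> series s @ \oo --> S ->
  exists t : nat -> R, (forall j, series (a ^~ j) @ \oo --> t j) /\
    series t @ \oo --> S.
Proof.
move=> a0 as_ sS.
have s0 i : 0 <= s i.
  by apply: le_trans (series_le_lim 0 (a0 i) (as_ i)); rewrite /series/= big_nil.
have ales i j : a i j <= s i.
  apply: le_trans (series_le_lim j.+1 (a0 i) (as_ i)).
  by rewrite /series /= big_nat_recr//= lerDr series_ge0.
have cj j : cvgn (series (a ^~ j)).
  by apply: (series_le_cvg (v_ := s)) => //; apply/cvg_ex; exists S.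
exists (fun j => limn (series (a ^~ j))); split => // .
have t0 j : 0 <= limn (series (a ^~ j)).
  by apply: limr_ge => //; apply: nearW => n; exact: series_ge0.
apply: EFin_cvg_series => //.
rewrite -(cvg_series_EFin sS).
under [RHS]eq_eseriesr do rewrite -(cvg_series_EFin (as_ _)).
rewrite nneseries_interchange; last by move=> i j; rewrite lee_fin.
by apply: eq_eseriesr => j _; rewrite (cvg_series_EFin (cj j)).
Qed.

(** Tonelli applies to the nonnegative arrays |a| and |a| + a; subtracting the two results gives the
    claim. A summable bound [s] on the absolute row sums suffices, so they need not be computed. *)
Lemma series_fubini (a : nat -> nat -> R) (s r t : nat -> R) :
  (forall i n, series (fun j => `|a i j|) n <= s i) -> cvgn (series s) ->
  (forall i, series (a i) @ \oo --> r i) ->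
  (forall j, series (a ^~ j) @ \oo --> t j) ->
  exists T : R, series r @ \oo --> T /\ series t @ \oo --> T.
Proof.
move=> als cs ar at_.
have s0 i : 0 <= s i by apply: le_trans (als i 0%N); rewrite /series/= big_nil.
have ca i : cvgn (series (fun j => `|a i j|)).
  exact: nonneg_series_bounded_cvg (als i).
pose q i := limn (series (fun j => `|a i j|)).
have aq i : series (fun j => `|a i j|) @ \oo --> q i := ca i.
have q0 i : 0 <= q i by apply: limr_ge => //; apply: nearW => n; exact: series_ge0.
have qs i : q i <= s i by apply: limr_le => //; apply: nearW => n; exact: als.
have rq i : `|r i| <= q i.
  rewrite -(cvg_lim _ (ar i))//; by apply: lim_series_norm; exact: ca.
have cq : cvgn (series q) by apply: (series_le_cvg (v_ := s)).
have cr : cvgn (series r) by apply: abs_cvg_series; exact: cvg_series_abs rq cq.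
pose Q := limn (series q); pose T := limn (series r).
have qQ : series q @ \oo --> Q := cq.
have rT : series r @ \oo --> T := cr.
have [t1 [at1 tQ]] := series_tonelli (fun i j => normr_ge0 (a i j)) aq qQ.
have arow i : series (fun j => `|a i j| + a i j) @ \oo --> q i + r i.
  exact: cvg_seriesD.
have [|t2 [at2 tQT]] := series_tonelli _ arow (cvg_seriesD qQ rT).
  by move=> i j; rewrite -lerBlDr sub0r ler_normr lexx orbT.
exists T; split => //.
have t2E j : t2 j = t1 j + t j.
  have /cvg_lim <- // := at2 j; apply/cvg_lim => //.
  exact: (cvg_seriesD (at1 j) (at_ j)).
have : series (fun j => t2 j + -1 * t1 j) @ \oo --> (Q + T) + -1 * Q.
  by apply: cvg_seriesD => //; exact: cvg_seriesZ.
have -> : Q + T + -1 * Q = T by ring.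
by rewrite (_ : (fun j => _) = t)//; apply/funext => j; rewrite t2E; ring.
Qed.

Lemma cvgn_series_unique u k l :
  series u @ \oo --> k -> series u @ \oo --> l -> k = l.
Proof. by move=> /cvg_lim <-// /cvg_lim <-. Qed.

End series_lemmas.

Arguments cvg_seriesZ {R} c {u l}.
Arguments cvg_series_shift {R u l} i.

(** * Convolution of sequences *)

Section convolution.
Context {R : realType}.
Implicit Types (a b c u v G : nat -> R).

Definition conv a b (n : nat) : R := \sum_(i < n.+1) a i * b (n - i)%N.

(** Entry n of a Cauchy product only sees entries up to n, so truncating to polynomials is harmless.
    The algebra of [conv] is thereby inherited from the polynomial ring. *)
Lemma conv_poly N a b n : (n < N)%N ->
  conv a b n = ((\poly_(i < N) a i) * (\poly_(i < N) b i))`_n.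
Proof.
move=> nN; rewrite coefM; apply: eq_bigr => i _.
by rewrite !coef_poly !ifT//; have := ltn_ord i; lia.
Qed.

Lemma convC a b : conv a b = conv b a.
Proof. by apply/funext => n; rewrite !(@conv_poly n.+1)// mulrC. Qed.

Lemma conv_conv_poly N a b c n : (n < N)%N ->
  conv (conv a b) c n =
  ((\poly_(i < N) a i) * (\poly_(i < N) b i) * (\poly_(i < N) c i))`_n.
Proof.
move=> nN; rewrite [RHS]coefM; apply: eq_bigr => i _.
have iN : (i < N)%N by have := ltn_ord i; lia.
by rewrite (conv_poly _ _ iN) [in RHS]coef_poly ifT//; lia.
Qed.

Lemma convA a b c : conv (conv a b) c = conv a (conv b c).
Proof.
apply/funext => n; rewrite (convC a (conv b c)) !(@conv_conv_poly n.+1)//.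
set a' := \poly_(_ < _) a _; set b' := \poly_(_ < _) b _.
set c' := \poly_(_ < _) c _.
by have -> : a' * b' * c' = b' * c' * a' by ring.
Qed.

Lemma convDl a b c :
  conv (fun i => a i + b i) c = (fun n => conv a c n + conv b c n).
Proof.
apply/funext => n; rewrite /conv -big_split /=.
by apply: eq_bigr => i _; rewrite mulrDl.
Qed.

Lemma convZl (k : R) a c : conv (fun i => k * a i) c = (fun n => k * conv a c n).
Proof.
apply/funext => n; rewrite /conv mulr_sumr.
by apply: eq_bigr => i _; rewrite mulrA.
Qed.

(** The Leibniz rule, read off from the derivative of a product of truncations. *)
Lemma pseries_diffs_conv a b : pseries_diffs (conv a b) =
  (fun n => conv (pseries_diffs a) b n + conv a (pseries_diffs b) n).
Proof.
have diffs_poly N u i : (i.+1 < N)%N ->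
    pseries_diffs u i = ((\poly_(j < N) u j)^`())`_i.
  by move=> iN; rewrite coef_deriv coef_poly iN /pseries_diffs mulr_natl.
apply/funext => n.
(* Entry n of a derivative involves index n + 1, hence the truncation at [n.+2]. *)
rewrite {1}/pseries_diffs (@conv_poly n.+2)// mulr_natl -coef_deriv derivM coefD.
rewrite !coefM; congr (_ + _); apply: eq_bigr => i _.
  rewrite -diffs_poly; last by have := ltn_ord i; lia.
  by rewrite coef_poly ifT//; have := ltn_ord i; lia.
rewrite -diffs_poly; last by have := ltn_ord i; lia.
by rewrite coef_poly ifT//; have := ltn_ord i; lia.
Qed.

(* Multiplication of the generating function by z. *)
Definition shift a (n : nat) : R := if n is m.+1 then a m else 0.

Lemma shift_conv a b : conv (shift a) b = shift (conv a b).
Proof.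
apply/funext => -[|n] /=; rewrite /conv; first by rewrite big_ord1 mul0r.
by rewrite big_ord_recl mul0r add0r; apply: eq_bigr => i _; rewrite subSS.
Qed.

(** The Euler operator z D: it expresses the factor k in a recursion through a derivation. *)
Lemma shift_pseries_diffs a : shift (pseries_diffs a) = (fun n => n%:R * a n).
Proof. by apply/funext => -[|n] //=; rewrite mul0r. Qed.

Lemma conv_ge0 a b n :
  (forall i, 0 <= a i) -> (forall i, 0 <= b i) -> 0 <= conv a b n.
Proof. by move=> a0 b0; apply: sumr_ge0 => i _; exact: mulr_ge0. Qed.

Lemma conv_geometric a b z :
  conv (fun i => a i * z ^+ i) (fun i => b i * z ^+ i) =
  (fun n => conv a b n * z ^+ n).
Proof.
apply/funext => n; rewrite /conv mulr_suml; apply: eq_bigr => i _.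
have -> : z ^+ n = z ^+ i * z ^+ (n - i) by rewrite -exprD subnKC// -ltnS ltn_ord.
by ring.
Qed.

(** Fubini for the triangular array a i * b (n - i) * G n with i <= n. The bounded weight [G] serves
    two purposes: [G] = 1 gives the product of two series, and a shifted test function gives the
    exchange of sums behind the Stein identity. *)
Lemma series_conv_bounded a b G (C : R) (r : nat -> R) :
  cvgn (series (fun i => `|a i|)) ->
  cvgn (series (fun i => `|b i|)) -> (forall n, `|G n| <= C) ->
  (forall i, series (fun j => b j * G (i + j)%N) @ \oo --> r i) ->
  exists T : R, series (fun i => a i * r i) @ \oo --> T /\
    series (fun n => conv a b n * G n) @ \oo --> T.
Proof.
move=> ca cb GC br.
have C0 : 0 <= C := le_trans (normr_ge0 _) (GC 0%N).
pose B : R := limn (series (fun i => `|b i|)).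
have bB : series (fun i => `|b i|) @ \oo --> B := cb.
(* The index n of [G] is written i + (n - i) so that row i is literally a sequence in j = n - i
   moved by i places. *)
pose x i n := if (i <= n)%N then a i * (b (n - i)%N * G (i + (n - i))%N) else 0.
have xabs i : (fun n => `|x i n|) = (fun n => if (i <= n)%N then
    (fun j => `|a i * (b j * G (i + j)%N)|) (n - i)%N else 0).
  by apply/funext => n; rewrite /x; case: ifP => // _; rewrite normr0.
apply: (@series_fubini R x (fun i => `|a i| * (C * B))).
- have xle i j : `|a i * (b j * G (i + j)%N)| <= `|a i| * (C * `|b j|).
    by rewrite !normrM [C * _]mulrC ler_wpM2l// ler_wpM2l.
  move=> i n.
  have sB : series (fun j => `|a i| * (C * `|b j|)) @ \oo --> `|a i| * (C * B).
    by apply: cvg_seriesZ; exact: cvg_seriesZ.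
  have cx : cvgn (series (fun j => `|a i * (b j * G (i + j)%N)|)).
    apply: (cvg_series_abs (v := fun j => `|a i| * (C * `|b j|))) => //.
    by apply/cvg_ex; eexists; exact: sB.
  have xs : series (fun n => `|x i n|) @ \oo -->
      limn (series (fun j => `|a i * (b j * G (i + j)%N)|)).
    rewrite xabs; apply: (@cvg_series_shift _ (fun j => `|a i * (b j * G (i + j)%N)|)).
    exact: cx.
  apply: le_trans (series_le_lim n _ xs) _; first by move=> j; exact: normr_ge0.
  rewrite -(cvg_lim _ sB)//; apply: lim_series_le => //.
  by apply/cvg_ex; eexists; exact: sB.
- have := cvg_seriesZ (C * B) (ca : series _ @ \oo --> _).
  under eq_fun do rewrite mulrC.
  by move=> h; apply/cvg_ex; eexists; exact: h.
- move=> i; apply: (cvg_series_shift (u := fun j => a i * (b j * G (i + j)%N))).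
  exact: cvg_seriesZ.
- move=> n; have -> : conv a b n * G n = \sum_(i < n.+1) x i n.
    rewrite /conv mulr_suml; apply: eq_bigr => i _; rewrite /x.
    have h : (i <= n)%N by rewrite -ltnS ltn_ord.
    by rewrite h subnKC// mulrA.
  by apply: cvg_series_finite => i ni; rewrite /x leqNgt ni.
Qed.

Lemma series_conv a b (A B : R) : cvgn (series (fun i => `|a i|)) ->
  cvgn (series (fun i => `|b i|)) ->
  series a @ \oo --> A -> series b @ \oo --> B ->
  series (conv a b) @ \oo --> A * B.
Proof.
move=> ca cb aA bB.
have [|i|T []] := @series_conv_bounded a b (fun=> 1) 1 (fun=> B) ca cb.
- by move=> n; rewrite normr1.
- by under eq_fun do rewrite mulr1.
have := cvg_seriesZ B aA; rewrite mulrC.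
under eq_fun do rewrite mulrC.
move=> h1 /(cvgn_series_unique h1) <-.
by under eq_fun do rewrite mulr1.
Qed.

Lemma abs_conv a b : cvgn (series (fun i => `|a i|)) ->
  cvgn (series (fun i => `|b i|)) -> cvgn (series (fun n => `|conv a b n|)).
Proof.
move=> ca cb.
apply: (@cvg_series_abs _ _ (conv (fun i => `|a i|) (fun i => `|b i|))).
  move=> n; apply: le_trans (ler_norm_sum _ _ _) _.
  by apply: ler_sum => i _; rewrite normrM.
apply/cvg_ex; eexists; apply: series_conv; last 2 first.
- exact: ca.
- exact: cb.
- by under eq_fun do rewrite normr_id.
- by under eq_fun do rewrite normr_id.
Qed.

End convolution.

(** * Laws of discrete random variables *)

Section discrete_laws.
Context d (T : measurableType d) (R : realType) (P : probability T R).
Implicit Types (X Y Z : T -> nat) (f h F : nat -> R).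

Lemma measurable_nat_fun (F : nat -> R) : measurable_fun [set: nat] F.
Proof. by []. Qed.

Lemma trivIset_fibers Y : trivIset setT (fun k => Y @^-1` [set k]).
Proof. by move=> i j _ _ [w [/= -> ->]]. Qed.

Lemma bigcup_fibers Y : \bigcup_k (Y @^-1` [set k]) = setT.
Proof. by apply/seteqP; split => // w _; exists (Y w). Qed.

Lemma measurable_fiber Y (A : set nat) :
  measurable_fun [set: T] Y -> measurable (Y @^-1` A).
Proof. by move=> mY; rewrite -[X in measurable X]setTI; exact: mY. Qed.

Lemma measure_fibers Y (B : set T) : measurable_fun [set: T] Y -> measurable B ->
  P B = (\sum_(0 <= i <oo) P (Y @^-1` [set i] `&` B))%E.
Proof.
move=> mY mB; rewrite -[in LHS](setTI B) -(bigcup_fibers Y) setI_bigcupl.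
rewrite measure_semi_bigcup//.
- by move=> i; apply: measurableI => //; exact: measurable_fiber.
- by move=> i j _ _ [w /= [[-> _] [-> _]]].
- apply: bigcup_measurable => i _; apply: measurableI => //.
  exact: measurable_fiber.
Qed.

(** The extra event [B] is carried along for the induction on partial sums, where it records
    conditions on the other variables. *)
Lemma measure_add_fiber Y Z (B : set T) k :
  measurable_fun [set: T] Y -> measurable_fun [set: T] Z -> measurable B ->
  P ((fun w => Y w + Z w)%N @^-1` [set k] `&` B) =
  (\sum_(i < k.+1) P (Y @^-1` [set val i] `&` Z @^-1` [set (k - i)%N] `&` B))%E.
Proof.
move=> mY mZ mB.
have mE : measurable ((fun w => Y w + Z w)%N @^-1` [set k] `&` B).
  apply: measurableI => //; apply: measurable_fiber; exact: measurable_fun_addn.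
rewrite (measure_fibers mY mE) (nneseries_split 0 k.+1); last first.
  by move=> i _; exact: measure_ge0.
rewrite add0n eseries0 ?adde0.
  rewrite big_mkord; apply: eq_bigr => i _; congr (P _).
  have ik : (i <= k)%N by rewrite -ltnS ltn_ord.
  apply/seteqP; split => w /=; rewrite /setI/=.
    move=> [Yi [YZk Bw]]; split=> //; split => //.
    by rewrite -(addKn (Y w) (Z w)) YZk Yi.
  by move=> [[Yi Zi] Bw]; split => //; split => //; rewrite Yi Zi subnKC.
(* Values of Y above k are incompatible with Y + Z = k. *)
move=> i ki _; rewrite (_ : _ `&` _ = set0) ?measure0//.
by apply/seteqP; split => w //= [wi [wk _]]; move: ki; rewrite -wi -wk; lia.
Qed.

Lemma pmf_ge0 Y h k : has_pmf P Y h -> 0 <= h k.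
Proof. by move=> Yh; rewrite -lee_fin -Yh measure_ge0. Qed.

Lemma pmf_series1 Y h : measurable_fun [set: T] Y -> has_pmf P Y h ->
  series h @ \oo --> (1 : R).
Proof.
move=> mY Yh; apply: EFin_cvg_series; first by move=> k; exact: pmf_ge0 Yh.
rewrite -(probability_setT P) (measure_fibers mY)//.
by apply: eq_eseriesr => k _; rewrite setIT Yh.
Qed.

Lemma pmf_add Y Z f h :
  measurable_fun [set: T] Y -> measurable_fun [set: T] Z ->
  has_pmf P Y f -> has_pmf P Z h ->
  (forall i j, P (Y @^-1` [set i] `&` Z @^-1` [set j]) =
    (P (Y @^-1` [set i]) * P (Z @^-1` [set j]))%E) ->
  has_pmf P (fun w => (Y w + Z w)%N) (conv f h).
Proof.
move=> mY mZ Yf Zh YZ k; rewrite -[X in P X]setIT measure_add_fiber//.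
rewrite /conv -sumEFin; apply: eq_bigr => i _.
by rewrite setIT YZ Yf Zh EFinM.
Qed.

(** The fibres of [Y] partition the space and the integrand is constant on each, so the integral
    becomes a series. It is done first for |F|, which gives integrability, then for F. *)
Lemma pmf_expectation Y h F : measurable_fun [set: T] Y -> has_pmf P Y h ->
  cvgn (series (fun k => `|h k * F k|)) ->
  P.-integrable [set: T] (fun w => (F (Y w))%:E) /\
  ('E_P[fun w => F (Y w)] = (limn (series (fun k => h k * F k)))%:E)%E.
Proof.
move=> mY Yh cF.
have mF (G : nat -> R) : measurable_fun [set: T] (fun w => (G (Y w))%:E).
  apply/measurable_EFinP; exact: (measurableT_comp (measurable_nat_fun G)).
have mYk k : measurable (Y @^-1` [set k]) by exact: measurable_fiber.
have intk (G : nat -> R) k :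
    (\int[P]_(w in Y @^-1` [set k]) (G (Y w))%:E = (h k * G k)%:E)%E.
  rewrite (eq_integral (cst (G k)%:E)); last by move=> w /set_mem /= ->.
  transitivity ((G k)%:E * P (Y @^-1` [set k]))%E; first exact: integral_cst.
  by rewrite Yh -EFinM mulrC.
have iF : P.-integrable [set: T] (fun w => (F (Y w))%:E).
  apply/integrableP; split => //.
  rewrite -(bigcup_fibers Y) ge0_integral_bigcup//; last 2 first.
  - rewrite bigcup_fibers; exact: (mF (fun k => `|F k|)).
  - exact: trivIset_fibers.
  under eq_eseriesr do rewrite (intk (fun k => `|F k|)).
  have sF : series (fun k => h k * `|F k|) @ \oo -->
      limn (series (fun k => `|h k * F k|)).
    rewrite (_ : (fun k => h k * `|F k|) = (fun k => `|h k * F k|)) //.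
    by apply/funext => k; rewrite normrM (ger0_norm (pmf_ge0 _ Yh)).
  by rewrite (cvg_series_EFin sF) ltry.
split => //; rewrite unlock -(bigcup_fibers Y) integral_bigcup//; last 2 first.
- exact: trivIset_fibers.
- by rewrite bigcup_fibers.
under eq_eseriesr do rewrite intk.
by apply: cvg_series_EFin; exact: abs_cvg_series.
Qed.

End discrete_laws.

(** * Convolution powers and random sums *)

Section convolution_power.
Context {R : realType}.
Variable u : nat -> R.

Fixpoint conv_pow (n : nat) : nat -> R :=
  if n is m.+1 then conv (conv_pow m) u else fun k => (k == 0)%:R.

Lemma conv_unit (a : nat -> R) : conv a (fun k => (k == 0)%:R) = a.
Proof.
apply/funext => n; rewrite convC /conv big_ord_recl subn0 mul1r big1 ?addr0//.
by move=> i _; rewrite mul0r.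
Qed.

Lemma conv_pow_ge0 n k : (forall i, 0 <= u i) -> 0 <= conv_pow n k.
Proof. by move=> u0; elim: n k => [|n IH] k /=; [exact: ler0n|exact: conv_ge0]. Qed.

(** The power rule for the derivation D, by induction from the Leibniz rule. *)
Lemma pseries_diffs_conv_pow n : pseries_diffs (conv_pow n.+1) =
  (fun k => n.+1%:R * conv (pseries_diffs u) (conv_pow n) k).
Proof.
elim: n => [|n IH].
  by rewrite /= convC conv_unit conv_unit; apply/funext => k; rewrite mul1r.
rewrite [conv_pow n.+2]/= pseries_diffs_conv IH convZl convA -/(conv_pow n.+1).
apply/funext => k; rewrite (convC (conv_pow n.+1)) -[n.+2]addn1 natrD; ring.
Qed.

Lemma conv_pow_series (z F : R) n :
  cvgn (series (fun k => `|u k * z ^+ k|)) ->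
  series (fun k => u k * z ^+ k) @ \oo --> F ->
  cvgn (series (fun k => `|conv_pow n k * z ^+ k|)) /\
  series (fun k => conv_pow n k * z ^+ k) @ \oo --> F ^+ n.
Proof.
move=> cu uF; elim: n => [|n [cn nF]] /=.
  split.
    have := @cvg_series_finite R (fun k => `|(k == 0)%:R * z ^+ k|) 1.
    move=> h; apply/cvg_ex; eexists; apply: h => -[|k]//=.
    by rewrite mul0r normr0.
  have := @cvg_series_finite R (fun k => (k == 0)%:R * z ^+ k) 1.
  by rewrite big_ord1 expr0 mul1r; apply => -[|k]//=; rewrite mul0r.
have zE := congr1 (fun f => f _) (conv_geometric (conv_pow n) u z).
split; first by under eq_fun do rewrite -zE; exact: abs_conv.
by under eq_fun do rewrite -zE; rewrite exprSr; exact: series_conv.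
Qed.

End convolution_power.

Section random_sum.
Context d (T : measurableType d) (R : realType) (P : probability T R).
Variables (N : T -> nat) (X : nat -> T -> nat) (u pi : nat -> R).
Hypotheses (mN : measurable_fun [set: T] N)
  (mX : forall j, measurable_fun [set: T] (X j)).
Hypotheses (Npi : has_pmf P N pi) (Xu : forall j, has_pmf P (X j) u).

Let family (i : option nat) : T -> nat := if i is Some j then X j else N.

Hypothesis indep : mutually_independent P family.

Let mfamily i : measurable_fun [set: T] (family i).
Proof. by case: i. Qed.

Let S m w := (\sum_(j < m) X j w)%N.

Let mS m : measurable_fun [set: T] (S m).
Proof.
elim: m => [|m IH].
  by rewrite /S; under eq_fun do rewrite big_ord0; exact: measurable_cst.
have -> : S m.+1 = (fun w => (S m w + X m w)%N).
  by apply/funext => w; rewrite /S big_ord_recr.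
exact: measurable_fun_addn.
Qed.

(** The statement is strengthened by conditions on finitely many members outside the first m
    summands. In the induction step the condition on the last summand is moved into [J]; mutual
    independence itself is used only at m = 0. *)
Let partial_sum_law m k (J : seq (option nat)) (A : option nat -> set nat) :
  uniq J -> (forall i, (i < m)%N -> Some i \notin J) ->
  P (S m @^-1` [set k] `&` \bigcap_(i in [set` J]) (family i @^-1` A i)) =
  ((conv_pow u m k)%:E * \prod_(i <- J) P (family i @^-1` A i))%E.
Proof.
elim: m k J A => [|m IH] k J A uJ mJ.
  rewrite -indep//= /S.
  case: eqP => [->|k0].
    rewrite mul1e; congr (P _); apply/seteqP; split => [w []//|w Bw].
    by split => //=; rewrite big_ord0.
  rewrite mul0e (_ : _ `&` _ = set0) ?measure0//.
  by apply/seteqP; split => w //= []; rewrite big_ord0 => /esym.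
have mB : measurable (\bigcap_(i in [set` J]) (family i @^-1` A i)).
  apply: fin_bigcap_measurable => // i _.
  exact: measurable_fiber.
have -> : S m.+1 = (fun w => (S m w + X m w)%N).
  by apply/funext => w; rewrite /S big_ord_recr.
rewrite measure_add_fiber// /= /conv -sumEFin ge0_sume_distrl; last first.
  move=> i _; rewrite lee_fin mulr_ge0 ?(pmf_ge0 _ (Xu 0))//.
  by apply: conv_pow_ge0 => j; exact: pmf_ge0 (Xu 0).
apply: eq_bigr => i _.
(* The last summand joins the list with its fibre over k - i; the other conditions are unchanged
   because [Some m] is not in [J]. *)
pose A' x := if x == Some m then [set (k - i)%N] else A x.
have mJ' : Some m \notin J by exact: mJ.
transitivity (P (S m @^-1` [set val i] `&`
    \bigcap_(x in [set` Some m :: J]) (family x @^-1` A' x))).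
  congr (P _); rewrite -setIA; congr (_ `&` _).
  apply/seteqP; split => w /=.
    move=> [Xm BJ] x; rewrite /= inE => /orP[/eqP ->|xJ].
      by rewrite /A' eqxx.
    rewrite /A'; case: eqP => [xm|_]; last exact: BJ.
    by rewrite xm in xJ; rewrite xJ in mJ'.
  move=> BJ; split.
    by have := BJ (Some m); rewrite /= inE eqxx /A' eqxx; exact.
  move=> x /= xJ; have := BJ x; rewrite /= inE xJ orbT /A' => /(_ isT).
  by case: eqP => // xm; rewrite -xm xJ in mJ'.
rewrite IH/=; last 2 first.
- by rewrite mJ'.
- move=> j jm; rewrite inE negb_or mJ ?(ltn_trans jm)// andbT.
  by apply/eqP => -[] jE; rewrite jE ltnn in jm.
have A'm : A' (Some m) = [set (k - i)%N] by rewrite /A' eqxx.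
rewrite big_cons /= A'm (Xu m) muleA EFinM; congr (_ * _)%E.
rewrite big_seq_cond [RHS]big_seq_cond; apply: eq_bigr => x; rewrite andbT => xJ.
by rewrite /A'; case: eqP => // xm; rewrite -xm xJ in mJ'.
Qed.

(** On the event N = n the random sum is the partial sum [S n], and the condition on [N] is the
    singleton list [[:: None]] in the law of partial sums. *)
Lemma random_sum_law k :
  P [set w | (\sum_(j < N w) X j w)%N = k] =
  (\sum_(0 <= n <oo) (pi n * conv_pow u n k)%:E)%E.
Proof.
have -> : [set w | (\sum_(j < N w) X j w)%N = k] =
    \bigcup_n (S n @^-1` [set k] `&` N @^-1` [set n]).
  apply/seteqP; split => w /=; first by move=> Sk; exists (N w).
  by move=> [n _ [/= <- <-]].
rewrite measure_semi_bigcup//; last 3 first.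
- by move=> n; apply: measurableI; exact: measurable_fiber.
- by move=> i j _ _ [w /= [[_ ->] [_ ->]]].
- by apply: bigcup_measurable => n _; apply: measurableI; exact: measurable_fiber.
apply: eq_eseriesr => n _.
have := @partial_sum_law n k [:: None] (fun=> [set n]) isT (fun _ _ => isT).
rewrite big_seq1 /= Npi mulrC EFinM => <-; congr (P (_ `&` _)).
apply/seteqP; split => [w Nw x|w h]; last exact: (h None (mem_head _ _)).
by rewrite /= inE => /eqP ->.
Qed.

End random_sum.

(** * Compound Poisson laws *)

Section compound_poisson_pmf.
Context {R : realType}.

Lemma cvg_series_sum m (x : nat -> nat -> R) (l : nat -> R) :
  (forall i, (i < m)%N -> series (x i) @ \oo --> l i) ->
  series (fun n => \sum_(i < m) x i n) @ \oo --> \sum_(i < m) l i.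
Proof.
elim: m => [|m IH] xl.
  rewrite big_ord0; have := @cvg_series_finite R (fun n => \sum_(i < 0) x i n) 0.
  by rewrite big_ord0; apply => i _; rewrite big_ord0.
rewrite big_ord_recr /=; under eq_fun do rewrite big_ord_recr /=.
apply: cvg_seriesD; last exact: xl.
by apply: IH => i im; apply: xl; rewrite ltnS ltnW.
Qed.

Lemma cvg_series_behead (x : nat -> R) (l : R) :
  series x @ \oo --> l -> series (fun n => x n.+1) @ \oo --> l - x 0%N.
Proof.
move=> xl; rewrite (_ : series _ = (fun n => series x n.+1 - x 0%N)); last first.
  by apply/funext => n; rewrite /series /= big_nat_recl// addrC addKr.
by apply: cvgB; [rewrite (cvg_shiftS (series x)) | exact: cvg_cst].
Qed.

Variables (rate : R) (u c : nat -> R).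
Hypotheses (rate0 : 0 < rate) (u0 : forall k, 0 <= u k)
  (u1 : series u @ \oo --> (1 : R)).
Hypothesis cE : forall k,
  series (fun n => poisson_pmf rate n * conv_pow u n k) @ \oo --> c k.

Lemma poisson_pmfS n :
  n.+1%:R * poisson_pmf rate n.+1 = rate * poisson_pmf rate n.
Proof.
rewrite /poisson_pmf rate0 factS natrM invfM exprS.
have n0 : n.+1%:R != 0 :> R by rewrite pnatr_eq0.
move: n0; set m := n.+1%:R => m0.
transitivity (m * m^-1 * (rate * (rate ^+ n * n`!%:R^-1 * expR (- rate)))).
  by ring.
by rewrite mulfV// mul1r.
Qed.

Lemma cvg_poisson_pgf (x : R) :
  series (fun n => poisson_pmf rate n * x ^+ n) @ \oo --> expR (rate * (x - 1)).
Proof.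
have -> : rate * (x - 1) = - rate + rate * x by ring.
rewrite expRD; under eq_fun.
  move=> n; have -> : poisson_pmf rate n * x ^+ n =
      expR (- rate) * exp_coeff (rate * x) n.
    by rewrite /poisson_pmf rate0 /exp_coeff /= exprMn; ring.
  over.
apply: cvg_seriesZ; exact: is_cvg_series_exp_coeff.
Qed.

(** Differentiate the mixture term by term: the power rule produces a factor n + 1 and lowers the
    exponent, and [poisson_pmfS] trades that factor for [rate]. *)
Lemma panjer_compound_poisson :
  pseries_diffs c = conv (fun j => rate * pseries_diffs u j) c.
Proof.
apply/funext => k.
have : series (fun n => k.+1%:R * (poisson_pmf rate n * conv_pow u n k.+1)) @ \oo
    --> pseries_diffs c k by exact: cvg_seriesZ.
(* The term n = 0 vanishes, as the zeroth convolution power is the unit mass at 0. *)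
move=> /cvg_series_behead; rewrite /= mulr0 mulr0 subr0.
have -> : (fun n => k.+1%:R * (poisson_pmf rate n.+1 * conv (conv_pow u n) u k.+1)) =
    (fun n => \sum_(i < k.+1) rate * pseries_diffs u i *
      (poisson_pmf rate n * conv_pow u n (k - i)%N)).
  apply/funext => n.
  have := congr1 (fun f => f k) (pseries_diffs_conv_pow u n).
  rewrite {1}/pseries_diffs /= mulrCA => ->.
  rewrite mulrA [poisson_pmf _ _ * _]mulrC poisson_pmfS /conv mulr_sumr.
  by apply: eq_bigr => i _; ring.
move=> h; apply: (cvgn_series_unique h).
apply: (@cvg_series_sum k.+1 (fun i n => rate * pseries_diffs u i *
      (poisson_pmf rate n * conv_pow u n (k - i)%N))
   (fun i => rate * pseries_diffs u i * c (k - i)%N)) => i _.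
exact: cvg_seriesZ.
Qed.

(** Fubini over the number n of summands and the value k. All convolution powers have mass 1, so row
    n is dominated by the Poisson weight; its sum is that weight times F ^ n, which leaves the
    Poisson generating function at F. *)
Lemma pgf_compound_poisson (z : R) : `|z| <= 1 ->
  series (fun k => c k * z ^+ k) @ \oo -->
  expR (rate * (limn (series (fun k => u k * z ^+ k)) - 1)).
Proof.
move=> z1.
have leu (w : nat -> R) k : (forall k, 0 <= w k) -> `|w k * z ^+ k| <= w k.
  by move=> w0; rewrite normrM ger0_norm// normrX ler_piMr// exprn_ile1.
have cu : cvgn (series (fun k => `|u k * z ^+ k|)).
  apply: (@cvg_series_abs _ _ u) => [k|]; first exact: leu.
  by apply/cvg_ex; eexists; exact: u1.
set F : R := limn _.
have uF : series (fun k => u k * z ^+ k) @ \oo --> F by exact: abs_cvg_series.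
have v0 n k : 0 <= conv_pow u n k by exact: conv_pow_ge0.
have v1 n : series (conv_pow u n) @ \oo --> (1 : R).
  have e1 (w : nat -> R) : (fun k => w k * 1 ^+ k) = w.
    by apply/funext => k; rewrite expr1n mulr1.
  have := @conv_pow_series R u 1 1 n; rewrite !e1 expr1n => h.
  apply: (h _ u1).2; under eq_fun do rewrite expr1n mulr1 ger0_norm//.
  by apply/cvg_ex; eexists; exact: u1.
have pi1 : series (poisson_pmf rate) @ \oo --> (1 : R).
  have := @cvg_poisson_pgf 1; rewrite subrr mulr0 expR0.
  by under eq_fun do rewrite expr1n mulr1.
have [||i|j|T [T1 T2]] := @series_fubini R
  (fun n k => poisson_pmf rate n * (conv_pow u n k * z ^+ k))
  (poisson_pmf rate) (fun n => poisson_pmf rate n * F ^+ n) (fun k => c k * z ^+ k).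
- move=> i n.
  apply: (@le_trans _ _ (series (fun k => poisson_pmf rate i * conv_pow u i k) n)).
    apply: ler_sum => k _; rewrite normrM ger0_norm ?poisson_pmf_ge0//.
    by rewrite ler_wpM2l ?poisson_pmf_ge0// leu.
  have := cvg_seriesZ (poisson_pmf rate i) (v1 i); rewrite mulr1; apply: series_le_lim.
  by move=> k; rewrite mulr_ge0 ?poisson_pmf_ge0.
- by apply/cvg_ex; eexists; exact: pi1.
- by apply: cvg_seriesZ; apply: (conv_pow_series _ cu uF).2.
- under eq_fun do rewrite mulrA mulrC.
  by rewrite mulrC; exact: cvg_seriesZ.
by rewrite (cvgn_series_unique (@cvg_poisson_pgf F) T1).
Qed.

End compound_poisson_pmf.

(** Replaces the random sum by numerical data: the summand law [u], including its mass at 0, and the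
    mass function [c] as a Poisson mixture of convolution powers. *)
Lemma compound_poisson_mixture d (T : measurableType d) (R : realType)
    (P : probability T R) (Y : {RV P >-> nat}) (lam : nat -> R) :
  compound_poisson P Y lam ->
  exists (rate : R) (u c : nat -> R),
    [/\ 0 < rate, has_pmf P Y c,
        (forall k, 0 <= u k) /\ series u @ \oo --> (1 : R),
        (forall j, (1 <= j)%N -> lam j = rate * u j) &
        forall k, series (fun n => poisson_pmf rate n * conv_pow u n k) @ \oo
          --> c k].
Proof.
move=> [d' [T' [P' [N [X [rate [[rate0 Npi] Xid indep lamE YE]]]]]]].
pose u k := fine (P' (X 0%N @^-1` [set k])).
pose c k := fine (P (Y @^-1` [set k])).
have Xu j : has_pmf P' (X j) u.
  by move=> k; rewrite Xid /u fineK// fin_num_measure//; exact: measurable_fiber.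
have Yc : has_pmf P Y c.
  by move=> k; rewrite /c fineK// fin_num_measure//; exact: measurable_fiber.
have u0 k : 0 <= u k by exact: pmf_ge0 (Xu 0%N).
exists rate, u, c; split => //.
- by split => //; apply: (pmf_series1 _ (Xu 0%N)).
- by move=> j j1; apply: EFin_inj; rewrite lamE// EFinM Xu.
- move=> k; apply: EFin_cvg_series.
    by move=> n; rewrite mulr_ge0 ?poisson_pmf_ge0 ?conv_pow_ge0.
  by rewrite -Yc YE; apply/esym; exact: (random_sum_law _ _ Npi Xu indep).
Qed.

(** Since [u] has mass 1, F - 1 is the series of u j * (z ^ j - 1), whose term at j = 0 is zero;
    neither [u 0] nor [lam 0] affects the exponent. *)
Lemma pgf_exponent (R : realType) (rate : R) (u lam : nat -> R) (z : R) :
  `|z| <= 1 -> (forall k, 0 <= u k) -> series u @ \oo --> (1 : R) ->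
  (forall j, (1 <= j)%N -> lam j = rate * u j) ->
  expR (rate * (limn (series (fun k => u k * z ^+ k)) - 1)) = G_cp lam z.
Proof.
move=> z1 u0 u1 lamE; congr expR; apply/esym/cvg_lim => //.
have uF : series (fun k => u k * z ^+ k) @ \oo -->
    limn (series (fun k => u k * z ^+ k)).
  apply: abs_cvg_series; apply: (@cvg_series_abs _ _ u) => [k|].
    by rewrite normrM ger0_norm// normrX ler_piMr// exprn_ile1.
  by apply/cvg_ex; eexists; exact: u1.
have := cvg_seriesZ rate (cvg_seriesD uF (cvg_seriesZ (-1) u1)).
rewrite mulr1; apply: cvg_trans; apply: near_eq_cvg.
exists 1%N => // n /= n1; rewrite /series /=.
rewrite (big_ltn n1) /= expr0 (_ : rate * _ = 0) ?add0r; last by ring.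
by apply: eq_big_nat => j /andP[j1 _]; rewrite lamE//; ring.
Qed.

(** * Panjer recursions and Stein operators *)

Section panjer_convolution.
Context {R : realType}.
Variables (s a b : R) (f c l : nat -> R).
Hypothesis fE : forall k, s * pseries_diffs f k = (a + b * k%:R) * f k.
Hypothesis cE : pseries_diffs c = conv l c.

Definition panjer_weight (k : nat) : R := s * l k - b * shift l k.

Lemma panjer_conv k : s * pseries_diffs (conv f c) k =
  (a + b * k%:R) * conv f c k + conv panjer_weight (conv f c) k.
Proof.
(* The Leibniz term in which [c] is differentiated. *)
have fcE : conv f (pseries_diffs c) = conv l (conv f c).
  by rewrite cE -convA (convC f) convA.
(* In terms of generating functions, (z f') c = z (f c)' - z f c', and f c' = l f c; this is the
   source of the shifted part of the weight. *)
have idE : conv (fun k => k%:R * f k) c =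
    (fun k => k%:R * conv f c k - conv (shift l) (conv f c) k).
  rewrite -shift_pseries_diffs !shift_conv; apply/funext => n.
  rewrite -(congr1 (fun v => v n) (shift_pseries_diffs (conv f c))).
  by rewrite pseries_diffs_conv fcE; case: n => [|n]/=; ring.
have wE : conv panjer_weight (conv f c) =
    (fun n => s * conv l (conv f c) n - b * conv (shift l) (conv f c) n).
  rewrite (_ : panjer_weight = (fun n => s * l n + (- b) * shift l n)).
    by rewrite convDl !convZl; apply/funext => n; ring.
  by apply/funext => n; rewrite /panjer_weight; ring.
have dfE : (fun n => s * conv (pseries_diffs f) c n) =
    (fun n => a * conv f c n + b * conv (fun k => k%:R * f k) c n).
  rewrite -convZl (_ : (fun _ => _) = (fun n => a * f n + b * (n%:R * f n))).
    by rewrite convDl !convZl.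
  by apply/funext => n; rewrite fE; ring.
rewrite pseries_diffs_conv mulrDr fcE (congr1 (fun v => v k) dfE) wE idE; ring.
Qed.

End panjer_convolution.

Section stein_recursion.
Context {R : realType}.
Variables (s a b W : R) (h w : nat -> R).
Hypotheses (s0 : 0 <= s) (bs : b < s) (h0 : forall k, 0 <= h k)
  (h1 : series h @ \oo --> (1 : R)) (cw : cvgn (series (fun k => `|w k|)))
  (wW : series w @ \oo --> W).
Hypothesis hE : forall k,
  s * pseries_diffs h k = (a + b * k%:R) * h k + conv w h k.

Let abs_h : cvgn (series (fun k => `|h k|)).
Proof.
under eq_fun do rewrite ger0_norm//.
by apply/cvg_ex; eexists; exact: h1.
Qed.

(** Summing the recursion up to n bounds s times the truncated mean by |a| + V plus b times the same
    truncated mean; as b < s, the truncated means are bounded. *)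
Lemma panjer_mean : cvgn (series (fun k => h k * k%:R)).
Proof.
pose V : R := limn (series (fun k => `|conv w h k|)).
have cwh : cvgn (series (fun k => `|conv w h k|)) by exact: abs_conv.
apply: (@nonneg_series_bounded_cvg _ _ ((`|a| + V) / (s - b))).
  by move=> k; rewrite mulr_ge0.
move=> n; rewrite ler_pdivlMr ?subr_gt0//.
set Tn := series _ n.
(* The derivative sums k * h k over one index more, and the additional term is nonnegative. *)
have TS : Tn <= series (fun k => pseries_diffs h k) n.
  have -> : series (fun k => pseries_diffs h k) n =
      series (fun k => h k * k%:R) n.+1.
    rewrite /series /= big_nat_recl//= mulr0 add0r.
    by apply: eq_bigr => i _; rewrite /pseries_diffs mulrC.
  by rewrite /series /= big_nat_recr//= lerDl mulr_ge0.
have : s * series (fun k => pseries_diffs h k) n =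
    a * series h n + b * Tn + series (fun k => conv w h k) n.
  rewrite /Tn /series /= !mulr_sumr -!big_split /=; apply: eq_bigr => k _.
  by rewrite hE; ring.
have : a * series h n <= `|a|.
  rewrite (le_trans (ler_norm _))// normrM ler_piMr//.
  rewrite ger0_norm ?series_ge0//; exact: series_le_lim.
have : series (fun k => conv w h k) n <= V.
  apply: (@le_trans _ _ (series (fun k => `|conv w h k|) n)).
    by apply: ler_sum => k _; exact: ler_norm.
  by apply: series_le_lim.
have : s * Tn <= s * series (fun k => pseries_diffs h k) n by rewrite ler_wpM2l.
rewrite mulrBr [Tn * s]mulrC [Tn * b]mulrC; lra.
Qed.

(** The part of the double sum that survives telescoping, with i = m - 1; the rest is - W * g (j +
    1) and cancels the [W] in the coefficient of g (j + 1). *)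
Let stein_tail g j : R := limn (series (fun i => w i * g (j + i).+1)).

Let stein_tailP (g : nat -> R) (C : R) j : (forall k, `|g k| <= C) ->
  series (fun i => w i * g (j + i).+1) @ \oo --> stein_tail g j /\
  `|stein_tail g j| <= C * limn (series (fun k => `|w k|)).
Proof.
move=> gC; have C0 : 0 <= C := le_trans (normr_ge0 _) (gC 0%N).
have wC : series (fun k => C * `|w k|) @ \oo --> C * limn (series (fun k => `|w k|)).
  exact: cvg_seriesZ.
have cwg : cvgn (series (fun i => `|w i * g (j + i).+1|)).
  apply: (@cvg_series_abs _ _ (fun k => C * `|w k|)).
    by move=> k; rewrite normrM mulrC ler_wpM2r.
  by apply/cvg_ex; eexists; exact: wC.
split; first exact: abs_cvg_series.
apply: le_trans (lim_series_norm cwg) _; rewrite -(cvg_lim _ wC)//.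
apply: (lim_series_le cwg) => [|k]; first by apply/cvg_ex; eexists; exact: wC.
by rewrite normrM mulrC ler_wpM2r.
Qed.

(** The common shape of both Stein operators, governed by the recursion coefficients [s], [a], [b]
    and the weight [w] of total [W]. *)
Definition stein_panjer (g : nat -> R) (j : nat) : R :=
  (a + W + b * j%:R) * g j.+1 - s * j%:R * g j +
  \big[+%R/0]_(2 <= m <oo) (w m.-1 * \sum_(1 <= l < m) Delta g (j + l)%N).

Let stein_panjerE (g : nat -> R) (C : R) j : (forall k, `|g k| <= C) ->
  stein_panjer g j =
  (a + b * j%:R) * g j.+1 - s * j%:R * g j + stein_tail g j.
Proof.
move=> gC; have [gt _] := stein_tailP j gC.
suff : (fun n => \sum_(2 <= m < n) (w m.-1 * \sum_(1 <= l < m) Delta g (j + l)%N))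
    @ \oo --> stein_tail g j + - g j.+1 * W.
  by move=> /cvg_lim tE; rewrite /stein_panjer tE//; ring.
rewrite -(cvg_shiftn 2).
have lim1 := cvg_seriesD gt (cvg_seriesZ (- g j.+1) wW).
rewrite -(cvg_shiftn 1) in lim1; apply: cvg_trans lim1; apply: near_eq_cvg.
apply: nearW => n /=.
rewrite addn1 addn2 /series /= big_nat_recl//= addn0.
(* The operator starts at m = 2, that is i = 1; the two contributions of i = 0 cancel. *)
rewrite (_ : _ + - g j.+1 * w 0%N = 0) ?add0r; last by ring.
rewrite 2!big_add1 /=.
apply: eq_bigr => i _.
rewrite (eq_big_nat _ _ (F2 := fun l => g (j + l.+1)%N - g (j + l)%N)); last first.
  by move=> l _; rewrite /Delta addnS.
by rewrite (telescope_sumr (fun l => g (j + l)%N))//= addn1 !addnS; ring.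
Qed.

(** The operator grows at most linearly in j, so the finite mean makes it summable against [h]. *)
Let stein_growth (g : nat -> R) (C : R) j : (forall k, `|g k| <= C) ->
  `|h j * stein_panjer g j| <=
  (`|a| + limn (series (fun k => `|w k|))) * C * h j +
  (`|b| + s) * C * (h j * j%:R).
Proof.
move=> gC; have [_ tC] := stein_tailP j gC.
have C0 : 0 <= C := le_trans (normr_ge0 _) (gC 0%N).
rewrite (stein_panjerE j gC) normrM (ger0_norm (h0 j)).
set V : R := limn _ in tC *.
apply: (@le_trans _ _ (h j * ((`|a| + `|b| * j%:R) * C + s * j%:R * C + C * V))).
  rewrite ler_wpM2l//.
  rewrite (le_trans (ler_normD _ _))// lerD//.
  rewrite (le_trans (ler_normB _ _))// lerD//.
    rewrite normrM ler_pM// (le_trans (ler_normD _ _))// lerD// normrM ler_wpM2l//.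
    by rewrite normr_nat.
  by rewrite !normrM (ger0_norm s0) normr_nat ler_wpM2l// mulr_ge0.
by rewrite le_eqVlt; apply/orP; left; apply/eqP; ring.
Qed.

Lemma stein_panjer_summable (g : nat -> R) (C : R) : (forall k, `|g k| <= C) ->
  cvgn (series (fun j => `|h j * stein_panjer g j|)).
Proof.
move=> gC; apply: (cvg_series_abs (fun j => stein_growth j gC)).
apply/cvg_ex; eexists; apply: cvg_seriesD.
  by apply: cvg_seriesZ; exact: h1.
by apply: cvg_seriesZ; exact: panjer_mean.
Qed.

(** The operator contains a limit; boundedness supplies the convergence that makes it additive. *)
Lemma stein_panjer_linear (x y : R) (g g' : nat -> R) (C C' : R) j :
  (forall k, `|g k| <= C) -> (forall k, `|g' k| <= C') ->
  stein_panjer (fun k => x * g k + y * g' k) j =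
  x * stein_panjer g j + y * stein_panjer g' j.
Proof.
move=> gC gC'.
have ggC k : `|x * g k + y * g' k| <= `|x| * C + `|y| * C'.
  by rewrite (le_trans (ler_normD _ _))// lerD// normrM ler_wpM2l.
rewrite (stein_panjerE j gC) (stein_panjerE j gC') (stein_panjerE j ggC).
have [t1 _] := stein_tailP j gC; have [t2 _] := stein_tailP j gC'.
have [t3 _] := stein_tailP j ggC.
have := cvg_seriesD (cvg_seriesZ x t1) (cvg_seriesZ y t2).
rewrite (_ : (fun i => _) = (fun i => w i * (x * g (j + i).+1 + y * g' (j + i).+1))).
  by move=> /(cvgn_series_unique t3) ->; ring.
by apply/funext => i; ring.
Qed.

(* Summation by parts: after exchanging the sums, the recursion turns the
   general term into the increment of [s * n * h n * g n]. *)
Lemma stein_panjer_sum0 (g : nat -> R) (C : R) : (forall k, `|g k| <= C) ->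
  series (fun j => h j * stein_panjer g j) @ \oo --> (0 : R).
Proof.
move=> gC.
have [T [T1 T2]] := @series_conv_bounded _ h w (fun n => g n.+1) C (stein_tail g)
  abs_h cw (fun n => gC n.+1) (fun i => (stein_tailP i gC).1).
have cS := abs_cvg_series (stein_panjer_summable gC).
pose L : R := limn (series (fun j => h j * stein_panjer g j)).
have SL : series (fun j => h j * stein_panjer g j) @ \oo --> L := cS.
(* The tail terms are exchanged for the convolution terms; both have total [T], so the limit [L] is
   unchanged. *)
have := cvg_seriesD (cvg_seriesD SL (cvg_seriesZ (-1) T1)) T2.
have -> : L + -1 * T + T = L by ring.
rewrite (_ : (fun i => _) =
  (fun i => s * (i.+1%:R * h i.+1 * g i.+1) - s * (i%:R * h i * g i))); last first.
  apply/funext => i; have := hE i; rewrite /pseries_diffs convC => hEi.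
  rewrite (stein_panjerE i gC).
  have -> : s * (i.+1%:R * h i.+1 * g i.+1) =
      s * (i.+1%:R * h i.+1) * g i.+1 by ring.
  by rewrite hEi; ring.
move=> SL'.
suff : series (fun i => s * (i.+1%:R * h i.+1 * g i.+1) - s * (i%:R * h i * g i))
    @ \oo --> (0 : R).
  by move=> /(cvgn_series_unique SL') <-.
rewrite (_ : series _ = (fun n => s * (h n * n%:R * g n))); last first.
  apply/funext => n; rewrite /series /=.
  rewrite (telescope_sumr (fun i => s * (i%:R * h i * g i)))//.
  by ring.
rewrite -(mulr0 s); apply: cvgMl_tmp.
(* The boundary term n * h n is the general term of the convergent mean series. *)
have := cvg_series_cvg_0 panjer_mean => hn0.
apply/norm_cvg0P.
apply: (@squeeze_cvgr _ _ _ _ (fun=> 0) (fun n => `|h n * n%:R| * C)).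
- apply: nearW => n; rewrite normr_ge0 /= normrM ler_wpM2l//.
- exact: cvg_cst.
- by rewrite -(mul0r C); apply: cvgMr_tmp; apply/norm_cvg0P.
Qed.

End stein_recursion.

Lemma stein_operator_panjer d (T : measurableType d) (R : realType)
    (P : probability T R) (Y : T -> nat) (s a b W : R) (h w : nat -> R) :
  measurable_fun [set: T] Y -> has_pmf P Y h ->
  0 <= s -> b < s -> cvgn (series (fun k => `|w k|)) ->
  series w @ \oo --> W ->
  (forall k, s * pseries_diffs h k = (a + b * k%:R) * h k + conv w h k) ->
  stein_operator P Y (stein_panjer s a b W w).
Proof.
move=> mY Yh s0 bs cw wW hE.
have h0 k : 0 <= h k := pmf_ge0 k Yh.
have h1 := pmf_series1 mY Yh.
split.
- apply: (pmf_expectation (F := fun k => k%:R) mY Yh _).1.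
  under eq_fun do rewrite ger0_norm ?mulr_ge0//.
  exact: (panjer_mean s0 bs h0 h1 cw hE).
- move=> x y g g' [[C gC] _ _] [[C' gC'] _ _] j.
  exact: stein_panjer_linear gC gC'.
- move=> g [[C gC] _ _].
  have [] := pmf_expectation (F := stein_panjer s a b W w g) mY Yh.
    exact: (stein_panjer_summable s0 bs h0 h1 cw wW hE gC).
  move=> ? ->; split => //; congr EFin; apply/cvg_lim => //.
  exact: (stein_panjer_sum0 s0 bs h0 h1 cw wW hE gC).
Qed.

(** * The functional equation of the Gamma function *)

Section gamma_recurrence.
Context {R : realType}.
Notation mu := (@lebesgue_measure R).

Lemma continuous_powR (p t : R) : 0 < t -> {for t, continuous (@powR R ^~ p)}.
Proof.
move=> t0; apply: differentiable_continuous; apply/derivable1_diffP.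
by apply: derivable_powR; rewrite in_itv/= t0.
Qed.

Lemma measurable_gamma_integrand (p : R) (D : set R) :
  measurable_fun D (fun t : R => (t `^ p * expR (- t))%:E).
Proof.
apply/measurable_EFinP; apply: measurable_funTS; apply: measurable_funM.
  exact: measurable_powR.
by apply: measurableT_comp => //; exact: measurable_oppr.
Qed.

(** The compact intervals [1 / (n + 1), n + 2] exhaust the open half-line and avoid 0, where the
    integrand may be singular. The bound n + 2 keeps the interval nondegenerate at n = 0. *)
Let lo (n : nat) : R := n.+1%:R^-1.
Let hi (n : nat) : R := n.+2%:R.

Let lo0 n : 0 < lo n. Proof. by rewrite invr_gt0. Qed.

Let lohi n : lo n < hi n.
Proof.
rewrite (@le_lt_trans _ _ 1)//; last by rewrite /hi ltr1n.
by rewrite invf_le1// ler1n.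
Qed.

(** At the lower end the power tends to 0. At the upper end, with a natural m >= x, the exponential
    series gives exp y >= y ^ (m + 1) / (m + 1)!, so the term is at most (m + 1)! / y. *)
Let boundary_cvg0 (x : R) : 0 < x ->
  (fun n => lo n `^ x * expR (- lo n) - hi n `^ x * expR (- hi n)) @ \oo --> (0 : R).
Proof.
move=> x0; rewrite -(subr0 0); apply: cvgB.
  apply: (@squeeze_cvgr _ _ _ _ (fun=> 0) (fun n => lo n `^ x)).
  - apply: nearW => n; rewrite mulr_ge0 ?powR_ge0 ?expR_ge0//=.
    by rewrite ler_piMr ?powR_ge0// -expR0 ler_expR oppr_le0 ltW.
  - exact: cvg_cst.
  - have /cvg_at_rightP := powR_cvg0 x0; apply; split => //.
    exact: cvg_harmonic.
pose m := Num.bound x.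
apply: (@squeeze_cvgr _ _ _ _ (fun=> 0) (fun n => m.+1`!%:R * harmonic n)).
- apply: nearW => n; rewrite mulr_ge0 ?powR_ge0 ?expR_ge0//=.
  have h1 : 1 <= hi n by rewrite ler1n.
  have h0 : 0 < hi n by exact: lt_le_trans h1.
  apply: (@le_trans _ _ (hi n ^+ m * expR (- hi n))).
    rewrite ler_wpM2r ?expR_ge0// -powR_mulrn ?(ltW h0)//.
    by apply: ler_powR => //; rewrite ltW// archi_boundP// ltW.
  apply: (@le_trans _ _ (m.+1`!%:R * (hi n)^-1)).
    rewrite expRN ler_pdivrMr ?expR_gt0//.
    have := expR_ge1Dxn m (ltW h0).
    move=> /(le_trans (ler_wpDl ler01 (lexx _))) le1.
    rewrite mulrAC ler_pdivlMr// -exprSr.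
    by rewrite -ler_pdivrMl ?ltr0n ?fact_gt0// mulrC.
  by rewrite ler_wpM2l// lef_pV2 ?posrE// ler_nat.
- exact: cvg_cst.
- rewrite -(mulr0 (m.+1`!%:R)); apply: cvgMl_tmp; exact: cvg_harmonic.
Qed.

Let gamma_part (p : R) (n : nat) : \bar R :=
  (\int[mu]_(t in `[lo n, hi n]) (t `^ p * expR (- t))%:E)%E.

Let gamma_full (p : R) : \bar R :=
  (\int[mu]_(t in `]0%R, +oo[) (t `^ p * expR (- t))%:E)%E.

Let gamma_part_cvg p : gamma_part p @ \oo --> gamma_full p.
Proof.
have -> : gamma_full p = (\int[mu]_(t in \bigcup_n `[lo n, hi n]%classic)
    (t `^ p * expR (- t))%:E)%E.
  rewrite /gamma_full; congr (integral _ _ _); apply/seteqP; split => t /=.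
    rewrite in_itv/= andbT => t0.
    have t0' := ltW t0.
    (* Large enough to exceed both t and 1 / t. *)
    pose n := maxn (Num.bound t) (Num.bound t^-1).
    exists n => //=; rewrite in_itv/=; apply/andP; split.
      rewrite /lo -(invrK t) lef_pV2 ?posrE ?invr_gt0//.
      rewrite ltW// (lt_le_trans (archi_boundP _)) ?invr_ge0//.
      by rewrite ler_nat /n; lia.
    rewrite ltW// (lt_le_trans (archi_boundP _))//.
    by rewrite /hi ler_nat /n; lia.
  move=> [n _]; rewrite /= !in_itv/= andbT => /andP[lt _].
  exact: lt_le_trans lt.
apply: ge0_nondecreasing_set_cvg_integral.
- move=> i j ij; rewrite subsetEset => t /=; rewrite !in_itv/= => /andP[it ti].
  apply/andP; split.
    by apply: le_trans it; rewrite lef_pV2 ?posrE// ler_nat.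
  by apply: le_trans ti _; rewrite ler_nat.
- by move=> i; exact: measurable_itv.
- by move=> i; exact: measurable_gamma_integrand.
- by move=> i t _; rewrite lee_fin mulr_ge0 ?powR_ge0 ?expR_ge0.
Qed.

(** Integration by parts with the antiderivative - exp (- t). *)
Let gamma_part_rec (x : R) n : 0 < x -> gamma_part x n =
  ((lo n `^ x * expR (- lo n) - hi n `^ x * expR (- hi n))%:E +
   x%:E * gamma_part (x - 1) n)%E.
Proof.
move=> x0.
have pos t : t \in `[lo n, hi n] -> 0 < t.
  by rewrite in_itv/= => /andP[h _]; exact: lt_le_trans h.
have posoo t : t \in `]lo n, hi n[ -> 0 < t.
  by move=> h; apply: pos; apply: subset_itv_oo_cc h.
have cexpN : continuous (fun t : R => expR (- t)).
  by move=> t; apply: continuous_comp; [exact: continuousN|exact: continuous_expR].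
have := @integration_by_parts R (@powR R ^~ x) (fun t => - expR (- t))
  (fun t => x * t `^ (x - 1)) (fun t => expR (- t)) (lo n) (hi n) (lohi n).
rewrite /gamma_part => ->.
- rewrite (_ : _ * _ - _ =
    lo n `^ x * expR (- lo n) - hi n `^ x * expR (- hi n)); last by ring.
  congr (_ + _)%E.
  under [X in (- X)%E]eq_integral do rewrite mulrN -mulrA EFinN EFinM.
  rewrite integral_ge0N; last first.
    move=> t /pos t0; rewrite -EFinM lee_fin !mulr_ge0 ?powR_ge0 ?expR_ge0//.
    exact: ltW.
  rewrite oppeK ge0_integralZl//.
  + exact: measurable_gamma_integrand.
  + by move=> t _; rewrite lee_fin mulr_ge0 ?powR_ge0 ?expR_ge0.
  + by rewrite lee_fin ltW.
- apply: continuous_in_subspaceT => t /set_mem /pos t0.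
  apply: (@continuousM _ _ (fun=> x) (fun y : R => y `^ (x - 1))).
    exact: cst_continuous.
  exact: continuous_powR.
- split.
  + by move=> t /posoo t0; apply: derivable_powR; rewrite in_itv/= t0.
  + by apply: cvg_at_right_filter; exact: continuous_powR.
  + by apply: cvg_at_left_filter; apply: continuous_powR; apply: lt_trans (lohi n).
- by move=> t /posoo t0; apply: powR_derive1; rewrite in_itv/= t0.
- by apply: continuous_subspaceT.
- split.
  + by move=> t _; apply: ex_derive.
  + by apply: cvg_at_right_filter; apply: cvgN; exact: cexpN.
  + by apply: cvg_at_left_filter; apply: cvgN; exact: cexpN.
- by move=> t _; rewrite derive1E derive_val; rewrite ?scaleN1r ?scalerN1; ring.
Qed.

Lemma Gamma_recurrence (x : R) : 0 < x -> Gamma (x + 1) = x * Gamma x.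
Proof.
move=> x0.
have E : gamma_full x = (x%:E * gamma_full (x - 1))%E.
  have lim1 := @gamma_part_cvg x.
  have lim2 : gamma_part x @ \oo --> (0%:E + x%:E * gamma_full (x - 1))%E.
    rewrite (_ : gamma_part x = fun n =>
       ((lo n `^ x * expR (- lo n) - hi n `^ x * expR (- hi n))%:E +
       x%:E * gamma_part (x - 1) n)%E).
      apply: cvgeD; first by rewrite fin_num_adde_defr.
        apply: cvg_EFin; first exact: nearW.
        exact: boundary_cvg0.
      by apply: cvgeZl => //; exact: gamma_part_cvg.
    by apply/funext => n; exact: gamma_part_rec.
  by rewrite -(cvg_lim _ lim1)// (cvg_lim _ lim2)// add0e.
have GE p : Gamma p = fine (gamma_full (p - 1)) by [].
rewrite !GE addrK E.
have : (0 <= gamma_full (x - 1))%E.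
  by apply: integral_ge0 => t _; rewrite lee_fin mulr_ge0 ?powR_ge0 ?expR_ge0.
(* Finiteness of the integral is not established: were it infinite, [fine] would send both sides to
   0. *)
case: (gamma_full (x - 1)) => [r| |]//= _.
by rewrite gt0_muley ?lte_fin// mulr0.
Qed.

End gamma_recurrence.

(** * The negative binomial series *)

Section negative_binomial_series.
Context {R : realType}.

Lemma is_derive0_const_ball (F : R -> R) (K z : R) :
  (forall x : R, `|x| < K -> is_derive x (1 : R) F 0) -> `|z| < K -> F z = F 0.
Proof.
move=> dF zK.
have K0 : 0 < K by exact: le_lt_trans zK.
have aux x y : x <= y -> `|x| < K -> `|y| < K -> F x = F y.
  move=> xy xK yK.
  have inK t : t \in `[x, y] -> `|t| < K.
    rewrite in_itv/= => /andP[xt ty]; move: xK yK.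
    rewrite !ltr_norml => /andP[? ?] /andP[? ?].
    by apply/andP; split; lra.
  have [||t _] := @MVT_segment R F (fun=> 0) x y xy.
  - by move=> t txy; apply: dF; apply: inK; exact: subset_itv_oo_cc txy.
  - apply: continuous_in_subspaceT => t /set_mem /inK tK.
    have [dFt _] := dF t tK.
    by apply: differentiable_continuous; apply/derivable1_diffP.
  - by rewrite mul0r => /eqP; rewrite subr_eq0 => /eqP.
by have [z0|z0] := leP z 0; [|apply/esym]; apply: aux; rewrite ?normr0// ltW.
Qed.

(** Put F k = f k * K ^ k and rho = q K < 1. Summing the recursion bounds (1 - rho) times the
    partial sum of k * F k by rho * r times that of F, while indices from [k0] on carry a factor at
    least [k0]; together these bound the partial sums of F. *)
Lemma neg_binomial_summable (r q K : R) (f : nat -> R) :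
  0 < r -> 0 <= q -> 0 <= K -> q * K < 1 -> (forall k, 0 <= f k) ->
  (forall k, pseries_diffs f k = q * (r + k%:R) * f k) -> cvgn (pseries f K).
Proof.
move=> r0 q0 K0 qK f0 fE.
pose rho := q * K; pose F k := f k * K ^+ k.
have rho0 : 0 <= rho by exact: mulr_ge0.
have F0 k : 0 <= F k by rewrite mulr_ge0 ?exprn_ge0.
have FE k : k.+1%:R * F k.+1 = rho * (r + k%:R) * F k.
  have := fE k; rewrite /pseries_diffs /F /rho exprS => h.
  by rewrite mulrA h; ring.
(* The summand 1 leaves one copy of the partial sum after rho * r copies are cancelled. *)
pose k0 := Num.bound ((rho * r + 1) / (1 - rho)).
have k0P : rho * r + 1 <= (1 - rho) * k0%:R.
  rewrite [leRHS]mulrC -ler_pdivrMr ?subr_gt0//.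
  apply: ltW; apply: archi_boundP; rewrite divr_ge0//; last by rewrite subr_ge0 ltW.
  by rewrite addr_ge0// mulr_ge0// ltW.
apply: (@nonneg_series_bounded_cvg _ F (k0%:R * series F k0)) => // n.
set B := series F k0.
have B0 : 0 <= B by exact: series_ge0.
pose Tn := series (fun k => k%:R * F k) n.
have TE : (1 - rho) * Tn <= rho * r * series F n.
  have : Tn <= series (fun k => k.+1%:R * F k.+1) n.
    have -> : series (fun k => k.+1%:R * F k.+1) n =
        series (fun k => k%:R * F k) n.+1.
      by rewrite [RHS]/series /= big_nat_recl// mul0r add0r.
    by rewrite [leRHS]/series /= big_nat_recr//= lerDl mulr_ge0.
  have -> : series (fun k => k.+1%:R * F k.+1) n = rho * r * series F n + rho * Tn.
    rewrite /Tn /series /= !mulr_sumr -big_split /=; apply: eq_bigr => k _.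
    by rewrite FE; ring.
  lra.
have TB : k0%:R * series F n - k0%:R * B <= Tn.
  have FB : series (fun k => if (k < k0)%N then F k else 0) n <= B.
    have -> : B = \sum_(k < k0) (if (k < k0)%N then F k else 0).
      by rewrite /B /series /= big_mkord; apply: eq_bigr => k _; rewrite ltn_ord.
    apply: series_le_lim; first by move=> k; case: ifP.
    by apply: cvg_series_finite => k; rewrite leqNgt => /negbTE ->.
  apply: (@le_trans _ _ (k0%:R * series F n -
      k0%:R * series (fun k => if (k < k0)%N then F k else 0) n)).
    by rewrite lerD2l lerN2 ler_wpM2l.
  rewrite /Tn /series /= !mulr_sumr -sumrB; apply: ler_sum => k _.
  case: ltnP => kk0; first by rewrite subrr mulr_ge0.
  by rewrite mulr0 subr0 ler_wpM2r// ler_nat.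
have S0 : 0 <= series F n by exact: series_ge0.
have h1 : (1 - rho) * (k0%:R * series F n - k0%:R * B) <= rho * r * series F n.
  by apply: le_trans TE; rewrite ler_wpM2l// subr_ge0 ltW.
have h2 : (rho * r + 1) * series F n <= (1 - rho) * k0%:R * series F n.
  by rewrite ler_wpM2r.
have h3 : 0 <= rho * (k0%:R * B) by rewrite !mulr_ge0.
nra.
Qed.

(** The recursion says (1 - q x) G' = q r G, so G x * (1 - q x) ^ r is constant, equal to its value
    f 0 at x = 0. *)
Lemma neg_binomial_series (r q : R) (f : nat -> R) (z : R) :
  0 < r -> 0 < q < 1 -> (forall k, 0 <= f k) ->
  (forall k, pseries_diffs f k = q * (r + k%:R) * f k) -> `|z| <= 1 ->
  series (fun k => f k * z ^+ k) @ \oo --> f 0%N * (1 - q * z) `^ (- r).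
Proof.
move=> r0 /andP[q0 q1] f0 fE z1.
(* A radius strictly between 1 and 1 / q, so that the open ball contains the points with |z| = 1. *)
pose K := 2 / (1 + q).
have Kgt1 : 1 < K by rewrite /K ltr_pdivlMr; lra.
have qK : q * K < 1 by rewrite /K mulrA ltr_pdivrMr; lra.
have K0 : 0 <= K by lra.
have KE : `|K| = K by rewrite ger0_norm.
(* Differentiation preserves the recursion with p raised by 1. Hence the first two derived series
   also converge at [K], as termwise differentiation requires. *)
have rec_diffs (p : R) (a : nat -> R) :
    (forall k, pseries_diffs a k = q * (p + k%:R) * a k) ->
    forall k, pseries_diffs (pseries_diffs a) k =
      q * (p + 1 + k%:R) * pseries_diffs a k.
  move=> aE k; rewrite {1}/pseries_diffs aE /pseries_diffs -natr1; ring.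
have diffs0 (a : nat -> R) :
    (forall k, 0 <= a k) -> forall k, 0 <= pseries_diffs a k.
  by move=> a0 k; rewrite mulr_ge0.
have c0 : cvgn (pseries f K) by exact: (neg_binomial_summable r0 (ltW q0)).
have c1 : cvgn (pseries (pseries_diffs f) K).
  apply: (@neg_binomial_summable (r + 1) q) => //; [lra|exact: ltW|exact: diffs0|].
  exact: rec_diffs.
have c2 : cvgn (pseries (pseries_diffs (pseries_diffs f)) K).
  apply: (@neg_binomial_summable (r + 1 + 1) q) => //; [lra|exact: ltW| |].
    exact: (diffs0 _ (diffs0 _ f0)).
  exact: (rec_diffs _ _ (rec_diffs _ _ fE)).
pose G x : R := limn (pseries f x).
pose G' x : R := limn (pseries (pseries_diffs f) x).
have dG (x : R) : `|x| < K -> is_derive x (1 : R) G (G' x).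
  by move=> xK; apply: (pseries_snd_diffs c0 c1 c2); rewrite KE.
have GP (x : R) : `|x| < K -> series (fun k => f k * x ^+ k) @ \oo --> G x.
  by move=> xK; apply: (is_cvg_pseries_inside c0); rewrite KE.
have G'P (x : R) : `|x| < K ->
    series (fun k => pseries_diffs f k * x ^+ k) @ \oo --> G' x.
  by move=> xK; apply: (is_cvg_pseries_inside c1); rewrite KE.
have ode (x : R) : `|x| < K -> (1 - q * x) * G' x = q * r * G x.
  move=> xK.
  have xG' : series (fun k => shift (pseries_diffs f) k * x ^+ k) @ \oo --> x * G' x.
    have := cvg_series_shift 1 (cvg_seriesZ x (G'P x xK)).
    rewrite (_ : (fun n => _) = (fun k => shift (pseries_diffs f) k * x ^+ k))//.
    apply/funext => -[|k] /=; first by rewrite mul0r.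
    by rewrite subSS subn0 exprS; ring.
  have := cvg_seriesD (cvg_seriesZ (q * r) (GP x xK)) (cvg_seriesZ q xG').
  rewrite (_ : (fun n => _) = (fun k => pseries_diffs f k * x ^+ k)).
    by move=> /(cvgn_series_unique (G'P x xK)) E; rewrite mulrBl mul1r {1}E; ring.
  by apply/funext => k; rewrite shift_pseries_diffs fE; ring.
have pos (x : R) : `|x| < K -> 0 < 1 - q * x.
  move=> xK; rewrite subr_gt0; apply: le_lt_trans qK.
  by rewrite ler_wpM2l ?ltW// (le_lt_trans (ler_norm x)).
pose H x := G x * (1 - q * x) `^ r.
have dH (x : R) : `|x| < K -> is_derive x (1 : R) H 0.
  move=> xK.
  have dl : is_derive x (1 : R) (fun y => 1 - q * y) (- q).
    by apply: is_derive_eq; rewrite add0r mul1r /GRing.scale/= mulr1.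
  have dp := @is_derive1_comp R (fun y : R => y `^ r) (fun y : R => 1 - q * y) x _ _
    (is_derive1_powR r (pos x xK)) dl.
  have := is_deriveM (dG x xK) dp.
  rewrite (_ : _ + _ = 0)//=.
  rewrite /GRing.scale/=.
  have -> : (1 - q * x) `^ r = (1 - q * x) * (1 - q * x) `^ (r - 1).
    by rewrite mulr_powRB1// ltW// pos.
  have := ode x xK => od.
  have -> : (1 - q * x) * (1 - q * x) `^ (r - 1) * G' x =
    (1 - q * x) `^ (r - 1) * ((1 - q * x) * G' x) by ring.
  by rewrite od; ring.
have zK : `|z| < K by exact: le_lt_trans z1 _.
have Hz : H z = H 0 by exact: (is_derive0_const_ball dH).
have G0 : G 0 = f 0%N.
  have h := GP 0; rewrite normr0 in h.
  have := @cvg_series_finite R (fun k => f k * 0 ^+ k) 1.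
  rewrite big_ord1 expr0 mulr1 => h'.
  apply: (cvgn_series_unique (h _)); first by lra.
  by apply: h' => -[|k]//; rewrite exprS mul0r mulr0.
rewrite /H G0 mulr0 subr0 powR1 mulr1 in Hz.
rewrite -Hz powRN mulfK; last by rewrite gt_eqF// powR_gt0// pos.
exact: GP.
Qed.

End negative_binomial_series.

(** * The two sums *)

Lemma mutually_independent_pair d (T : measurableType d) (R : realType)
    (P : probability T R) (I : eqType) (X : I -> T -> nat) (i j : I)
    (A B : set nat) :
  mutually_independent P X -> i != j ->
  P (X i @^-1` A `&` X j @^-1` B) = (P (X i @^-1` A) * P (X j @^-1` B))%E.
Proof.
move=> indep ij.
have := indep [:: i; j] (fun x => if x == i then A else B).
rewrite /= inE ij => /(_ isT).
rewrite !big_cons big_nil mule1 eqxx eq_sym (negbTE ij) => <-.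
congr (P _); apply/seteqP; split => w /=.
  move=> [Aw Bw] x; rewrite /= !inE => /orP[/eqP->|/eqP->]; first by rewrite eqxx.
  by rewrite eq_sym (negbTE ij).
move=> h; split.
  by have := h i; rewrite /= inE !eqxx => /(_ isT).
by have := h j; rewrite /= !inE eqxx orbT eq_sym (negbTE ij) => /(_ isT).
Qed.

Section panjer_weight_series.
Context {R : realType}.

Lemma cvg_series_shift1 (l : nat -> R) (L : R) :
  series l @ \oo --> L -> series (shift l) @ \oo --> L.
Proof.
move=> /(cvg_series_shift 1); rewrite (_ : (fun n => _) = shift l)//.
by apply/funext => -[|n] //=; rewrite subSS subn0.
Qed.

(** Shifting does not change the total of [l], hence the factor s - b. *)
Lemma series_panjer_weight (s b L : R) (l : nat -> R) :
  (forall k, 0 <= l k) -> series l @ \oo --> L ->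
  cvgn (series (fun k => `|panjer_weight s b l k|)) /\
  series (panjer_weight s b l) @ \oo --> (s - b) * L.
Proof.
move=> l0 lL.
have wE (x y : R) :
      series (fun k => x * l k + y * shift l k) @ \oo --> x * L + y * L.
  by apply: cvg_seriesD; apply: cvg_seriesZ => //; exact: cvg_series_shift1.
split.
  apply: (@cvg_series_abs _ _ (fun k => `|s| * l k + `|b| * shift l k)).
    move=> k; rewrite (le_trans (ler_normB _ _))// !normrM (ger0_norm (l0 k)).
    by rewrite (@ger0_norm _ (shift l k))//; case: k => //=.
  by apply/cvg_ex; eexists; exact: wE.
have := wE s (- b); rewrite -mulrDl.
rewrite (_ : (fun k => _) = panjer_weight s b l)//.
by apply/funext => k; rewrite /panjer_weight mulNr.
Qed.

Lemma series_pseries_diffs (lam : nat -> R) (lambda : R) :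
  (forall j, (1 <= j)%N -> 0 <= lam j) ->
  (\sum_(1 <= j <oo) (j%:R * lam j)%:E)%E = lambda%:E ->
  series (pseries_diffs lam) @ \oo --> lambda.
Proof.
move=> lam0 lamL; apply: EFin_cvg_series.
  by move=> i; rewrite mulr_ge0// lam0.
rewrite -lamL -[RHS](@nneseries_addn _ _ 1); last first.
  by move=> [|i]; rewrite lee_fin ?mul0r// mulr_ge0// lam0.
by apply: eq_eseriesr => i _; rewrite addn1.
Qed.

End panjer_weight_series.

(** Treats both sums at once; the generating function [F] of the first summand is left open for each
    law to supply. *)
Lemma panjer_plus_compound_poisson d (T : measurableType d) (R : realType)
    (P : probability T R) (Y Z : {RV P >-> nat}) (f lam : nat -> R)
    (lambda s a b : R) :
  has_pmf P Y f -> compound_poisson P Z lam ->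
  (forall i j, P (Y @^-1` [set i] `&` Z @^-1` [set j]) =
    (P (Y @^-1` [set i]) * P (Z @^-1` [set j]))%E) ->
  (forall j, (1 <= j)%N -> 0 <= lam j) ->
  (\sum_(1 <= j <oo) (j%:R * lam j)%:E)%E = lambda%:E ->
  0 <= s -> b < s ->
  (forall k, s * pseries_diffs f k = (a + b * k%:R) * f k) ->
  (forall z F : R, `|z| <= 1 -> series (fun k => f k * z ^+ k) @ \oo --> F ->
    pgf P (fun w => (Y w + Z w)%N) z = (F * G_cp lam z)%:E) /\
  stein_operator P (fun w => (Y w + Z w)%N)
    (stein_panjer s a b ((s - b) * lambda) (panjer_weight s b (pseries_diffs lam))).
Proof.
move=> Yf Zlam YZ lam0 lamL s0 bs fE.
have [rate [u [c [rate0 Zc [u0 u1] lamE cE]]]] := compound_poisson_mixture Zlam.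
have c0 k : 0 <= c k := pmf_ge0 k Zc.
have f0 k : 0 <= f k := pmf_ge0 k Yf.
have f1 : series f @ \oo --> (1 : R) by exact: pmf_series1 Yf.
have c1 : series c @ \oo --> (1 : R) by exact: pmf_series1 Zc.
have mYZ : measurable_fun [set: T] (fun w => (Y w + Z w)%N).
  exact: measurable_fun_addn.
have YZh : has_pmf P (fun w => (Y w + Z w)%N) (conv f c) by exact: pmf_add.
(* Entry j reads index j + 1, so the unconstrained [lam 0] does not occur. *)
have lE : (fun j => rate * pseries_diffs u j) = pseries_diffs lam.
  by apply/funext => j; rewrite /pseries_diffs lamE//; ring.
split.
  move=> z F z1 fF.
  have abs1 (x : nat -> R) : (forall k, 0 <= x k) -> series x @ \oo --> (1 : R) ->
      cvgn (series (fun k => `|x k * z ^+ k|)).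
    move=> x0 x1; apply: (@cvg_series_abs _ _ x) => [k|].
      by rewrite normrM ger0_norm// normrX ler_piMr// exprn_ile1.
    by apply/cvg_ex; eexists; exact: x1.
  have cG : series (fun k => c k * z ^+ k) @ \oo --> G_cp lam z.
    rewrite -(pgf_exponent z1 u0 u1 lamE).
    exact: pgf_compound_poisson.
  have hFG := series_conv (abs1 f f0 f1) (abs1 c c0 c1) fF cG.
  rewrite conv_geometric in hFG.
  rewrite /pgf; have [|_ ->] := pmf_expectation (F := fun k => z ^+ k) mYZ YZh.
    have := abs_conv (abs1 f f0 f1) (abs1 c c0 c1).
    by rewrite conv_geometric.
  by rewrite (cvg_lim _ hFG).
have [cw wW] := series_panjer_weight s b
  (fun k => mulr_ge0 (ler0n _ _) (lam0 k.+1 isT))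
  (series_pseries_diffs lam0 lamL).
apply: (stein_operator_panjer mYZ YZh s0 bs cw wW).
apply: panjer_conv => //.
by rewrite (panjer_compound_poisson rate0 cE) lE.
Qed.

(** * Recursions and generating functions of the binomial and negative binomial laws *)

Section binomial_pmf.
Context {R : realType}.
Variables (M : nat) (p : R).

Lemma binomial_pmfE k :
  binomial_pmf M p k = p ^+ k * (1 - p) ^+ (M - k) * 'C(M, k)%:R.
Proof. by rewrite mulr_natr. Qed.

Lemma binomial_pmf_panjer k :
  (1 - p) * pseries_diffs (binomial_pmf M p) k =
  (p * M%:R + - p * k%:R) * binomial_pmf M p k.
Proof.
rewrite /pseries_diffs !binomial_pmfE.
have [kM|Mk] := ltnP k M; last first.
  rewrite [in LHS]bin_small// !mulr0.
  (* At k = M the right-hand side vanishes through the factor M - k, beyond M through the binomial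
     coefficient. *)
  move: Mk; rewrite leq_eqVlt => /orP[/eqP ->|Mk]; first by ring.
  by rewrite bin_small// !mulr0.
have binE : k.+1%:R * 'C(M, k.+1)%:R = (M%:R - k%:R) * 'C(M, k)%:R :> R.
  by rewrite -natrM mul_bin_left natrM natrB// ltnW.
rewrite -(subnSK kM) [in RHS]exprS.
transitivity (p * p ^+ k * (1 - p) * (1 - p) ^+ (M - k.+1) *
    (k.+1%:R * 'C(M, k.+1)%:R)); first by rewrite exprS; ring.
by rewrite binE; ring.
Qed.

Lemma binomial_pmf_series z :
  series (fun k => binomial_pmf M p k * z ^+ k) @ \oo --> (1 - p + p * z) ^+ M.
Proof.
have := @cvg_series_finite R (fun k => binomial_pmf M p k * z ^+ k) M.+1.
rewrite exprDn (_ : \sum_(i < M.+1) _ =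
  \sum_(i < M.+1) ((1 - p) ^+ (M - i) * (p * z) ^+ i) *+ 'C(M, i)).
  by apply => i Mi; rewrite binomial_pmfE bin_small// mulr0 mul0r.
by apply: eq_bigr => i _; rewrite binomial_pmfE exprMn -[RHS]mulr_natr; ring.
Qed.

End binomial_pmf.

Section negative_binomial_pmf.
Context {R : realType}.
Variables (r pbar : R).
Hypotheses (r0 : 0 < r) (p01 : 0 < pbar < 1).

(** The functional equation of Gamma supplies the factor r + k. *)
Lemma negative_binomial_pmf_panjer k :
  pseries_diffs (negative_binomial_pmf r pbar) k =
  (1 - pbar) * (r + k%:R) * negative_binomial_pmf r pbar k.
Proof.
rewrite /pseries_diffs /negative_binomial_pmf.
have -> : r + k.+1%:R = r + k%:R + 1 by rewrite -natr1 addrA.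
rewrite Gamma_recurrence; last by rewrite ltr_pwDl.
rewrite factS natrM !invfM exprS.
have : k.+1%:R != 0 :> R by rewrite pnatr_eq0.
set m := k.+1%:R => m0; set G := Gamma (_ + _).
transitivity (m * m^-1 * ((1 - pbar) * (r + k%:R) *
  (G * ((Gamma r)^-1 * k`!%:R^-1) * pbar `^ r * (1 - pbar) ^+ k))); first by ring.
by rewrite mulfV// mul1r.
Qed.

(* [Gamma r = 0] would make the whole mass function vanish, as division by zero
   returns zero. *)
Lemma negative_binomial_pmf0 :
  series (negative_binomial_pmf r pbar) @ \oo --> (1 : R) ->
  negative_binomial_pmf r pbar 0 = pbar `^ r.
Proof.
move=> f1.
have G0 : Gamma r != 0.
  apply/eqP => G0.
  have := @cvg_series_finite R (negative_binomial_pmf r pbar) 0.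
  rewrite big_ord0 => /(_ _)/(cvgn_series_unique f1) => h.
  have /eqP : (1 : R) = 0.
    by apply: h => i _; rewrite /negative_binomial_pmf G0 mul0r invr0 mulr0 !mul0r.
  by rewrite oner_eq0.
by rewrite /negative_binomial_pmf mulr0n addr0 fact0 expr0 !mulr1 divff// mul1r.
Qed.

Lemma negative_binomial_pmf_series z :
  (forall k, 0 <= negative_binomial_pmf r pbar k) ->
  series (negative_binomial_pmf r pbar) @ \oo --> (1 : R) -> `|z| <= 1 ->
  series (fun k => negative_binomial_pmf r pbar k * z ^+ k) @ \oo -->
    (pbar / (1 - (1 - pbar) * z)) `^ r.
Proof.
move=> f0 f1 z1; have /andP[p0 p1] := p01.
have q0 : 0 < 1 - pbar by rewrite subr_gt0.
have pos : 0 <= 1 - (1 - pbar) * z.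
  have : (1 - pbar) * z <= 1 - pbar.
    by rewrite ler_piMr ?(ltW q0)// (le_trans (ler_norm z)).
  lra.
rewrite powRM ?invr_ge0 ?(ltW p0)// -powR_inv1// -powRrM mulN1r.
rewrite -negative_binomial_pmf0//; apply: neg_binomial_series => //.
  by apply/andP; split; lra.
exact: negative_binomial_pmf_panjer.
Qed.

End negative_binomial_pmf.

Theorem proposition2p1 (R : realType) (d : measure_display)
    (T : measurableType d) (P : probability T R) (Y2 Y3 Y4 : {RV P >-> nat})
    (M : nat) (p q r pbar qbar : R) (lam : nat -> R) (lambda : R)
    (hM : (1 <= M)%N) (hp : 0 < p < 1) (hq : q = 1 - p)
    (hY2 : has_pmf P Y2 (binomial_pmf M p))
    (hr : 0 < r) (hpbar : 0 < pbar < 1) (hqbar : qbar = 1 - pbar)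
    (hY3 : has_pmf P Y3 (negative_binomial_pmf r pbar))
    (hlam : forall j, (1 <= j)%N -> 0 <= lam j)
    (hlambda : (\sum_(1 <= j <oo) (j%:R * lam j)%:E)%E = lambda%:E)
    (hY4 : compound_poisson P Y4 lam)
    (hindep : mutually_independent P
       (fun i : 'I_3 => tnth [tuple Y2 : T -> nat; Y3 : T -> nat; Y4 : T -> nat] i)) :
  let Y24 := fun w : T => (Y2 w + Y4 w)%N in
  let Y34 := fun w : T => (Y3 w + Y4 w)%N in
  ((forall z : R, `|z| <= 1 ->
      pgf P Y24 z = ((q + p * z) ^+ M * G_cp lam z)%:E) /\
   stein_operator P Y24 (fun (g : nat -> R) (j : nat) =>
     (M%:R + lambda / p - j%:R) * p * g j.+1 - q * j%:R * g j +
     \big[+%R/0]_(2 <= m <oo)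
       ((q * m%:R * lam m + p * (m - 1)%:R * lam (m - 1)%N) *
       \sum_(1 <= l < m) Delta g (j + l)%N))) /\
  ((forall z : R, `|z| <= 1 ->
      pgf P Y34 z = ((pbar / (1 - qbar * z)) `^ r * G_cp lam z)%:E) /\
   stein_operator P Y34 (fun (g : nat -> R) (j : nat) =>
     (lambda * pbar / qbar + r + j%:R) * qbar * g j.+1 - j%:R * g j +
     \big[+%R/0]_(2 <= m <oo)
       ((m%:R * lam m - qbar * (m - 1)%:R * lam (m - 1)%N) *
       \sum_(1 <= l < m) Delta g (j + l)%N))).
Proof.
have /andP[p0 p1] := hp; have /andP[pb0 pb1] := hpbar.
have ind i j (A B : set nat) :=
  mutually_independent_pair (i := i) (j := j) A B hindep.
have nb0 k : 0 <= negative_binomial_pmf r pbar k := pmf_ge0 k hY3.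
have nb1 : series (negative_binomial_pmf r pbar) @ \oo --> (1 : R).
  exact: pmf_series1 hY3.
(* The sums start at m = 2, so the stated coefficient at k + 2 is compared with the weight at k + 1,
   where [shift] takes its successor branch. *)
have lim_eq (x y t : nat -> R) : (forall k, x k.+2 = y k.+1) ->
    \big[+%R/0]_(2 <= m <oo) (x m * t m) =
    \big[+%R/0]_(2 <= m <oo) (y m.-1 * t m).
  move=> xy; congr (lim (_ @ \oo)); apply/funext => n.
  by apply: eq_big_nat => -[|[|m]]// _; rewrite xy.
move=> Y24 Y34; split.
- have [||k|pgf24 stein24] := @panjer_plus_compound_poisson _ _ _ _ _ _ _ _ _
      q (p * M%:R) (- p) hY2 hY4
      (fun i j => ind ord0 (Ordinal (isT : 2 < 3)%N) [set i] [set j] isT) hlam hlambda.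
  + by rewrite hq subr_ge0 ltW.
  + by rewrite hq; lra.
  + by rewrite hq; exact: binomial_pmf_panjer.
  split.
    by move=> z z1; apply: pgf24 => //; rewrite hq; exact: binomial_pmf_series.
  rewrite (_ : (fun g j => _) = stein_panjer q (p * M%:R) (- p) ((q - - p) * lambda)
      (panjer_weight q (- p) (pseries_diffs lam)))//.
  apply/funext => g; apply/funext => j; rewrite /stein_panjer; congr (_ + _).
    (* As q + p = 1, the coefficient (M + lambda / p - j) p equals p M + (q + p) lambda - p j. *)
    by rewrite hq; field; rewrite gt_eqF.
  apply: (lim_eq (fun m => q * m%:R * lam m + p * (m - 1)%:R * lam (m - 1)%N)).
  by move=> k; rewrite /panjer_weight /pseries_diffs /= subn1 /=; ring.
- have [||k|pgf34 stein34] := @panjer_plus_compound_poisson _ _ _ _ _ _ _ _ _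
      1 (qbar * r) qbar hY3 hY4
      (fun i j => ind (Ordinal (isT : 1 < 3)%N) (Ordinal (isT : 2 < 3)%N)
        [set i] [set j] isT) hlam hlambda.
  + exact: ler01.
  + by rewrite hqbar; lra.
  + by rewrite mul1r negative_binomial_pmf_panjer// hqbar; ring.
  split.
    move=> z z1; apply: pgf34 => //; rewrite hqbar.
    exact: negative_binomial_pmf_series.
  rewrite (_ : (fun g j => _) = stein_panjer 1 (qbar * r) qbar ((1 - qbar) * lambda)
      (panjer_weight 1 qbar (pseries_diffs lam)))//.
  apply/funext => g; apply/funext => j; rewrite /stein_panjer; congr (_ + _).
    (* Here the total of the weight is (1 - qbar) lambda = pbar * lambda. *)
    by rewrite hqbar; field; rewrite gt_eqF// subr_gt0.
  apply: (lim_eq (fun m => m%:R * lam m - qbar * (m - 1)%:R * lam (m - 1)%N)).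
  by move=> k; rewrite /panjer_weight /pseries_diffs /= subn1 /=; ring.
Qed.
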